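(* Let $L/F$ be a normal extension of number fields with Galois group $\Gamma = \mathrm{Gal}(L/F)$. Let $p$ be a prime not dividing $\#\Gamma$, and assume that $\mathrm{Cl}_p(K/F) = 1$ for all normal subextensions $K/F$ with $F \subseteq K \subsetneq L$. Let $\Phi$ denote the representation $\Phi : \Gamma \longrightarrow \mathrm{Aut}(C)$ induced by the action of $\Gamma$ on $C = \mathrm{Cl}(L/F)/\mathrm{Cl}(L/F)^p$; then $\Phi$ is faithful. If the degrees of all irreducible faithful $\mathbb{F}_p$-characters $\chi$ of $\Gamma$ are divisible by $f$, then $\mathrm{rank}\, \mathrm{Cl}_p(L) \equiv 0 \bmod f$. If, in addition, $(\mathbb{F}_p(\chi) : \mathbb{F}_p) = r$ for all these $\chi$, then $\mathrm{rank}\, \mathrm{Cl}_p(L) \equiv 0 \bmod rf$.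
   Context: For a number field $L$, $\mathrm{Cl}(L)$ is the ideal class group in the usual (wide) sense and $\mathrm{Cl}_p(L)$ is its $p$-Sylow subgroup. For an extension $L/F$ of number fields, the relative class group $\mathrm{Cl}(L/F)$ is the kernel of the norm homomorphism $N_{L/F}: \mathrm{Cl}(L) \to \mathrm{Cl}(F)$, and $\mathrm{Cl}_p(L/F)$ is its $p$-Sylow subgroup. The rank of a finite abelian $p$-group $A$ is $\dim_{\mathbb{F}_p} A/A^p$. A field $E$ is a splitting field for a finite group $\Gamma$ if every irreducible $E$-representation of $\Gamma$ remains irreducible over every extension field of $E$. The ''irreducible $\mathbb{F}_p$-characters'' $\chi$ of $\Gamma$ in the claim are the trace functions $\chi:\Gamma\to E$ of irreducible $E$-representations of $\Gamma$, where $E \supseteq \mathbb{F}_p$ is a splitting field for $\Gamma$; the degree of $\chi$ is the dimension of that representation. A representation is faithful if its kernel is trivial; a character is faithful if the representation affording it is faithful. $\mathbb{F}_p(\chi)$ is the smallest extension of $\mathbb{F}_p$ (inside $E$) containing all values $\chi(g)$, $g\in\Gamma$, and $(\mathbb{F}_p(\chi):\mathbb{F}_p)$ denotes its degree over $\mathbb{F}_p$.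
   Formalization: Faithfulness of Φ is proved when C is nontrivial (it fails for Q(i)/Q, p=3); the congruences mod f and mod rf are proved for rank Cl_p(L/F), and for rank Cl_p(L) when Cl_p(F)=1, since as stated they fail when Cl_p(F) is nontrivial. *)

(* Defs.v *)
From HB Require Import structures.
From mathcomp Require Import all_boot all_order all_algebra.
From mathcomp Require Import all_fingroup all_solvable all_field all_character.
From mathcomp Require Import boolp classical_sets.
From mathcomp Require Import ring_quotient.

Set Implicit Arguments.
Unset Strict Implicit.
Unset Printing Implicit Defensive.

Import GRing.Theory.
Local Open Scope classical_set_scope.
Local Open Scope ring_scope.

(* Abelian groups (class groups included) are written additively: the powers
   and p-th powers of classes are multiples here. *)

Section AbelianGroups.
Variables (V : zmodType) (p : nat).

Definition pmul : {pred V} := [pred x | `[< exists y : V, x = y *+ p >]].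

Fact pmul_zmod_closed : zmod_closed pmul.
Proof.
split=> [|x y]; first by apply/asboolP; exists 0; rewrite mul0rn.
move=> /asboolP[a ->] /asboolP[b ->]; apply/asboolP.
by exists (a - b); rewrite mulrnBl.
Qed.
HB.instance Definition _ := GRing.isZmodClosed.Build V pmul pmul_zmod_closed.

Definition pquot : Type := Quotient.quot pmul.
HB.instance Definition _ := GRing.Zmodule.on pquot.
HB.instance Definition _ := EqQuotient.on pquot.

(* For finite V the elements of p-power order form the p-Sylow subgroup. *)
Definition ptorsion : {pred V} := [pred x | `[< exists k, x *+ p ^ k = 0 >]].

Fact ptorsion_zmod_closed : zmod_closed ptorsion.
Proof.
split=> [|x y]; first by apply/asboolP; exists 0%N; rewrite mul0rn.
move=> /asboolP[a xa] /asboolP[b yb]; apply/asboolP.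
exists (a + b)%N; rewrite mulrnBl expnD mulrnA xa mul0rn sub0r.
by rewrite mulnC mulrnA yb mul0rn oppr0.
Qed.
HB.instance Definition _ :=
  GRing.isZmodClosed.Build V ptorsion ptorsion_zmod_closed.

Record sylow := Sylow { sylow_val :> V; _ : sylow_val \in ptorsion }.
HB.instance Definition _ := [isSub for sylow_val].
HB.instance Definition _ := [Choice of sylow by <:].
HB.instance Definition _ := [SubChoice_isSubZmodule of sylow by <:].

(* S is an F_p-subspace of V of dimension n; an additive map out of F_p^n is
   automatically F_p-linear. *)
Definition has_fp_dim (S : set V) (n : nat) : Prop :=
  exists f : {additive 'rV['F_p]_n -> V}, injective f /\ range f = S.

End AbelianGroups.

(* dim V/pV over F_p, with value 0 if that space is infinite-dimensional. *)
Definition prank (p : nat) (V : zmodType) : nat :=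
  xget 0%N [set n | has_fp_dim p [set: pquot V p] n].

Section PquotMap.
Variables (V : zmodType) (p : nat) (f : {additive V -> V}).
Local Open Scope quotient_scope.

Definition pquot_map (c : pquot V p) : pquot V p :=
  \pi_(pquot V p) (f (generic_quotient.repr c)).

Lemma pquot_mapE x : pquot_map (\pi x) = \pi_(pquot V p) (f x).
Proof.
apply/eqP; rewrite -Quotient.idealrBE -raddfB.
have : generic_quotient.repr (\pi_(pquot V p) x) - x \in pmul p.
  by rewrite Quotient.idealrBE reprK.
by case/asboolP=> y ->; apply/asboolP; exists (f y); rewrite raddfMn.
Qed.

Fact pquot_map_zmod_morphism : zmod_morphism pquot_map.
Proof.
move=> a b; rewrite -[a]reprK -[b]reprK.
by rewrite -[in LHS]raddfB !pquot_mapE !raddfB.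
Qed.
HB.instance Definition _ :=
  GRing.isZmodMorphism.Build _ _ pquot_map pquot_map_zmod_morphism.

End PquotMap.

(* L/F is a finite normal extension of number fields; K : {subfield L} ranges
   over the intermediate fields, and 1%AS is F itself. *)
Section ClassGroup.
Variables (F : fieldExtType rat) (L : splittingFieldType F).
Implicit Types (K : {subfield L}) (I J : set L).

Definition ring_int K : set L :=
  [set x | x \in K /\ integralOver (intr : int -> L) x].

Definition is_submod K I : Prop :=
  [/\ I `<=` [set x | x \in K], I 0, forall x y, I x -> I y -> I (x + y)
    & forall a x, ring_int K a -> I x -> I (a * x)].

Definition idealM I J : set L :=
  [set x | exists s : seq (L * L),
     (forall ab, ab \in s -> I ab.1 /\ J ab.2) /\
     x = \sum_(ab <- s) ab.1 * ab.2].

(* O_K is a Dedekind domain, so the invertible submodules of K are exactly the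
   (nonzero) fractional ideals. *)
Definition is_fracideal K I : Prop :=
  is_submod K I /\ exists2 J, is_submod K J & idealM I J = ring_int K.

Lemma ring_int1 K : ring_int K 1.
Proof. by split; [exact: mem1v | exact: integral1]. Qed.

Lemma ring_int_submod K : is_submod K (ring_int K).
Proof.
split=> [x []//||x y [Kx ix] [Ky iy]|x y [Kx ix] [Ky iy]].
- by split; [exact: mem0v | exact: integral0].
- by split; [exact: rpredD | exact: integral_add].
- by split; [exact: rpredM | exact: integral_mul].
Qed.

Lemma ring_intN K x : ring_int K x -> ring_int K (- x).
Proof. by case=> Kx ix; split; [rewrite rpredN | exact: integral_opp]. Qed.

Lemma idealM_mul I J x y : I x -> J y -> idealM I J (x * y).
Proof.
move=> Ix Jy; exists [:: (x, y)]; rewrite big_seq1; split=> // ab.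
by rewrite inE => /eqP->.
Qed.

Lemma idealM0 I J : idealM I J 0.
Proof. by exists [::]; rewrite big_nil. Qed.

Lemma idealMD I J x y : idealM I J x -> idealM I J y -> idealM I J (x + y).
Proof.
case=> s [sIJ ->] [t [tIJ ->]]; exists (s ++ t); rewrite big_cat; split=> // ab.
by rewrite mem_cat => /orP[/sIJ|/tIJ].
Qed.

Lemma idealM_min I J (S : set L) :
    S 0 -> (forall x y, S x -> S y -> S (x + y)) ->
    (forall x y, I x -> J y -> S (x * y)) ->
  idealM I J `<=` S.
Proof.
move=> S0 SD SM _ [s [sIJ ->]]; rewrite big_seq; apply: big_ind => //.
by move=> ab /sIJ[]; apply: SM.
Qed.

Lemma idealM_submod K I J :
  is_submod K I -> is_submod K J -> is_submod K (idealM I J).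
Proof.
move=> [IK I0 ID IM] [JK J0 JD JM]; split.
- apply: idealM_min => /= [|x y Kx Ky|x y /IK Kx /JK Ky].
  + exact: mem0v.
  + exact: rpredD.
  + exact: rpredM.
- exact: idealM0.
- exact: idealMD.
move=> a x Oa; move: x; apply: (@idealM_min _ _ [set x | idealM I J (a * x)]).
- by rewrite /= mulr0; apply: idealM0.
- by move=> x y /= ax ay; rewrite mulrDr; apply: idealMD.
- by move=> x y Ix Jy; rewrite /= mulrA; apply: idealM_mul => //; apply: IM.
Qed.

Lemma idealMC I J : idealM I J = idealM J I.
Proof.
have sub I' J' : idealM I' J' `<=` idealM J' I'.
  apply: idealM_min; [exact: idealM0 | exact: idealMD |].
  by move=> x y I'x J'y; rewrite mulrC; apply: idealM_mul.
by apply/seteqP; split; apply: sub.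
Qed.

Lemma idealMA I J H : idealM I (idealM J H) = idealM (idealM I J) H.
Proof.
have sub I' J' H' :
    idealM I' (idealM J' H') `<=` idealM (idealM I' J') H'.
  apply: idealM_min; [exact: idealM0 | exact: idealMD |].
  move=> x y I'x; move: y.
  apply: (@idealM_min _ _ [set y | idealM (idealM I' J') H' (x * y)]).
  - by rewrite /= mulr0; apply: idealM0.
  - by move=> u v /= ? ?; rewrite mulrDr; apply: idealMD.
  - by move=> u v ? ?; rewrite /= mulrA; do 2?apply: idealM_mul.
apply/seteqP; split; first exact: sub.
rewrite [X in X `<=` _]idealMC (idealMC I J) [X in _ `<=` X]idealMC.
by rewrite (idealMC J H); apply: sub.
Qed.

Lemma idealMO K I : is_submod K I -> idealM I (ring_int K) = I.
Proof.
case=> IK I0 ID IM; apply/seteqP; split.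
  by apply: idealM_min => // x y Ix Oy; rewrite mulrC; apply: IM.
by move=> x Ix; rewrite -[x]mulr1; apply: idealM_mul => //; apply: ring_int1.
Qed.

Lemma fracideal_ring_int K : is_fracideal K (ring_int K).
Proof.
have sO := ring_int_submod K.
by split=> //; exists (ring_int K) => //; apply: idealMO.
Qed.

Lemma fracidealM K I J :
  is_fracideal K I -> is_fracideal K J -> is_fracideal K (idealM I J).
Proof.
move=> [sI [I' sI' II']] [sJ [J' sJ' JJ']].
split; first exact: idealM_submod.
exists (idealM I' J'); first exact: idealM_submod.
rewrite idealMA -(idealMA I) (idealMC J) (idealMA I) II' -idealMA JJ'.
exact/idealMO/ring_int_submod.
Qed.

Record fracideal K :=
  FracIdeal { fracideal_set :> set L; _ : `[< is_fracideal K fracideal_set >] }.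

Section FracIdealGroup.
Variable K : {subfield L}.

HB.instance Definition _ := [isSub for @fracideal_set K].
HB.instance Definition _ := [Choice of fracideal K by <:].

Lemma fracidealP (a : fracideal K) : is_fracideal K a.
Proof. by apply/asboolP; case: a. Qed.

Lemma fracideal_inj (a b : fracideal K) : a = b :> set L -> a = b.
Proof. exact: val_inj. Qed.

Definition mk_fracideal I (fI : is_fracideal K I) : fracideal K :=
  FracIdeal (asboolT fI).

Definition fracideal_one : fracideal K :=
  mk_fracideal (fracideal_ring_int K).

Definition fracideal_mul (a b : fracideal K) : fracideal K :=
  mk_fracideal (fracidealM (fracidealP a) (fracidealP b)).

Fact fracideal_inv_ex (a : fracideal K) :
  exists b : fracideal K, fracideal_mul b a = fracideal_one.
Proof.
have [sa [b sb ab]] := fracidealP a.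
have fb : is_fracideal K b by split=> //; exists a; rewrite // idealMC.
by exists (mk_fracideal fb); apply: fracideal_inj; rewrite /= idealMC.
Qed.

Definition fracideal_inv (a : fracideal K) : fracideal K :=
  projT1 (cid (fracideal_inv_ex a)).

Fact fracideal_mulA : associative fracideal_mul.
Proof. by move=> a b c; apply: fracideal_inj; apply: idealMA. Qed.

Fact fracideal_mulC : commutative fracideal_mul.
Proof. by move=> a b; apply: fracideal_inj; apply: idealMC. Qed.

Fact fracideal_mul1 : left_id fracideal_one fracideal_mul.
Proof.
move=> a; apply: fracideal_inj; rewrite /= idealMC idealMO //.
by case: (fracidealP a).
Qed.

Fact fracideal_mulV : left_inverse fracideal_one fracideal_inv fracideal_mul.
Proof. by move=> a; rewrite /fracideal_inv; case: cid. Qed.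

HB.instance Definition _ := GRing.isZmodule.Build (fracideal K)
  fracideal_mulA fracideal_mulC fracideal_mul1 fracideal_mulV.

Lemma fracidealDE (a b : fracideal K) :
  a + b = idealM a b :> set L.
Proof. by []. Qed.

Lemma fracideal0E : (0 : fracideal K) = ring_int K :> set L.
Proof. by []. Qed.

Definition principal : {pred fracideal K} :=
  [pred a : fracideal K | `[< exists x : L, [/\ x \in K, x != 0 &
                  a = [set x * y | y in ring_int K] :> set L] >]].

Fact principal_zmod_closed : zmod_closed principal.
Proof.
have idealM_princ (x y : L) : idealM [set x * z | z in ring_int K]
    [set y * z | z in ring_int K] = [set x * y * z | z in ring_int K].
  have [_ O0 OD OM] := ring_int_submod K.
  apply/seteqP; split.
    apply: idealM_min.
    - by exists 0; rewrite ?mulr0.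
    - move=> _ _ [u Ou <-] [v Ov <-].
      by exists (u + v); [exact: OD | rewrite mulrDr].
    - move=> _ _ [u Ou <-] [v Ov <-].
      by exists (u * v); [exact: OM | rewrite mulrACA].
  move=> _ [z Oz <-]; rewrite -mulrA -[x in x * _]mulr1.
  apply: idealM_mul; last by exists z.
  by exists 1; [exact: ring_int1|].
have princ0 : 0 \in principal.
  apply/asboolP; exists 1; split; [exact: mem1v | exact: oner_neq0 |].
  by rewrite fracideal0E; under eq_imagel do rewrite mul1r; rewrite image_id.
split=> // a b /asboolP[x [Kx x0 ax]] /asboolP[y [Ky y0 by_]].
apply/asboolP; exists (x / y).
split; [exact: rpred_div | by rewrite mulf_neq0 ?invr_eq0 |].
have O1 : [set 1 * z | z in ring_int K] = ring_int K.
  by under eq_imagel do rewrite mul1r; rewrite image_id.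
have [sab _] := fracidealP (a - b).
have eab : idealM (a - b : fracideal K) b = a by rewrite -fracidealDE subrK.
transitivity (idealM a [set y^-1 * z | z in ring_int K]).
  by rewrite -eab -idealMA by_ idealM_princ mulfV // O1 idealMO.
by rewrite ax idealM_princ.
Qed.
HB.instance Definition _ :=
  GRing.isZmodClosed.Build _ principal principal_zmod_closed.

Definition Cl : Type := Quotient.quot principal.
HB.instance Definition _ := GRing.Zmodule.on Cl.
HB.instance Definition _ := EqQuotient.on Cl.

End FracIdealGroup.

Section Galois.
Variable K : {subfield L}.
Implicit Types (s t : gal_of K) (a b : fracideal K).

Lemma ring_int_gal s x : ring_int K x -> ring_int K (s x).
Proof.
case=> Kx [q qm qx]; split; first exact: memv_gal.
exists q => //; have := rmorph_root s qx; rewrite -map_poly_comp.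
by rewrite (@eq_map_poly _ _ _ intr) // => z /=; rewrite rmorph_int.
Qed.

Lemma gal_submod s I : is_submod K I -> is_submod K [set s x | x in I].
Proof.
move=> [IK I0 ID IM]; split.
- by move=> _ [x /IK Kx <-]; apply: memv_gal.
- by exists 0; rewrite ?raddf0.
- by move=> _ _ [x Ix <-] [y Iy <-]; exists (x + y); rewrite ?raddfD //; apply: ID.
move=> a _ Oa [x Ix <-]; exists ((s^-1)%g a * x).
  by apply: IM => //; apply: ring_int_gal.
have [Ka _] := Oa.
by rewrite rmorphM /= -galM // mulVg gal_id.
Qed.

Lemma gal_idealM s I J : [set s x | x in idealM I J] =
  idealM [set s x | x in I] [set s x | x in J].
Proof.
apply/seteqP; split.
  move=> _ [x IJx <-]; move: x IJx.
  apply: (@idealM_min _ _ [set x | idealM _ _ (s x)]).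
  - by rewrite /= raddf0; apply: idealM0.
  - by move=> x y /= ? ?; rewrite raddfD; apply: idealMD.
  - by move=> x y Ix Jy /=; rewrite rmorphM; apply: idealM_mul; [exists x|exists y].
apply: idealM_min.
- by exists 0; rewrite ?raddf0 //; apply: idealM0.
- move=> _ _ [x xI <-] [y yI <-]; exists (x + y); rewrite ?raddfD //.
  exact: idealMD.
- move=> _ _ [x xI <-] [y yI <-]; exists (x * y); rewrite ?rmorphM //.
  exact: idealM_mul.
Qed.

Lemma gal_ring_int s : [set s x | x in ring_int K] = ring_int K.
Proof.
apply/seteqP; split=> [_ [x Ox <-]|x Ox]; first exact: ring_int_gal.
exists ((s^-1)%g x); first exact: ring_int_gal.
by have [Kx _] := Ox; rewrite -galM // mulVg gal_id.
Qed.

Fact fracideal_gal s a : is_fracideal K [set s x | x in (a : set L)].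
Proof.
have [sa [b sb ab]] := fracidealP a; split; first exact: gal_submod.
exists [set s x | x in b]; first exact: gal_submod.
by rewrite -gal_idealM ab gal_ring_int.
Qed.

Definition gal_fracideal s a : fracideal K := mk_fracideal (fracideal_gal s a).

Fact gal_fracideal_zmod_morphism s : zmod_morphism (gal_fracideal s).
Proof.
have D : {morph gal_fracideal s : a b / a + b}.
  by move=> a b; apply: fracideal_inj; rewrite /= gal_idealM.
by move=> a b; apply: (addIr (gal_fracideal s b)); rewrite -D !subrK.
Qed.
HB.instance Definition _ s := GRing.isZmodMorphism.Build _ _
  (gal_fracideal s) (gal_fracideal_zmod_morphism s).

Lemma fracideal_ext (a : fracideal 1%AS) :
  is_fracideal K (idealM a (ring_int K)).
Proof.
have sO := ring_int_submod K.
have OO : ring_int 1%AS `<=` ring_int K.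
  by move=> x [Fx ix]; split=> //; apply: (subvP (sub1v K)).
have subm I : is_submod 1%AS I -> is_submod K (idealM I (ring_int K)).
  move=> [IF _ _ _]; split.
  - apply: idealM_min => /= [|x y|x y /IF Fx [Ky _]].
    + exact: mem0v.
    + exact: rpredD.
    + by rewrite rpredM //; apply: (subvP (sub1v K)).
  - exact: idealM0.
  - exact: idealMD.
  move=> c x Oc; move: x.
  apply: (@idealM_min _ _ [set x | idealM I (ring_int K) (c * x)]).
  - by rewrite /= mulr0; apply: idealM0.
  - by move=> x y /= ? ?; rewrite mulrDr; apply: idealMD.
  - move=> x y Ix Oy /=; rewrite mulrCA; apply: idealM_mul => //.
    by case: sO => _ _ _; apply.
have [sa [b sb ab]] := fracidealP a; split; first exact: subm.
exists (idealM b (ring_int K)); first exact: subm.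
rewrite idealMA -(idealMA a) (idealMC _ b) idealMA ab -idealMA (idealMO sO).
apply/seteqP; split.
  case: sO => _ O0 OD OM; apply: idealM_min => // x y /OO Ox Oy; exact: OM.
by move=> x Ox; rewrite -[x]mul1r; apply: idealM_mul => //; apply: ring_int1.
Qed.

(* The extension a |-> a O_K of fractional ideals from F to K. *)
Definition ext_fracideal (a : fracideal 1%AS) : fracideal K :=
  mk_fracideal (fracideal_ext a).

Fact ext_fracideal_zmod_morphism : zmod_morphism ext_fracideal.
Proof.
have sO := ring_int_submod K.
have D : {morph ext_fracideal : a b / a + b}.
  move=> a b; apply: fracideal_inj; rewrite fracidealDE /=.
  rewrite -[RHS]idealMA (idealMC (ring_int K) (idealM b _)).
  rewrite -(idealMA b) (idealMO sO).
  by rewrite idealMA.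
by move=> a b; apply: (addIr (ext_fracideal b)); rewrite -D !subrK.
Qed.
HB.instance Definition _ := GRing.isZmodMorphism.Build _ _
  ext_fracideal ext_fracideal_zmod_morphism.

(* For K/F normal, the norm of a fractional ideal a of K is the fractional
   ideal b of F such that b O_K is the product of the conjugates of a; b exists
   and is unique. *)
Definition is_norm a (b : fracideal 1%AS) : Prop :=
  ext_fracideal b = \sum_(s in 'Gal(K / 1)%g) gal_fracideal s a.

(* d = N_{K/F}(c) as ideal classes *)
Definition is_norm_class (c : Cl K) (d : Cl 1%AS) : Prop :=
  exists (a : fracideal K) (b : fracideal 1%AS),
    [/\ c = \pi_(Cl K)%qT a, d = \pi_(Cl 1%AS)%qT b & is_norm a b].

Definition norm_ker : {pred Cl K} := [pred c | `[< is_norm_class c 0 >]].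

Fact norm_ker_zmod_closed : zmod_closed norm_ker.
Proof.
split.
  apply/asboolP; exists 0, 0; split; rewrite ?raddf0 //.
  by rewrite /is_norm raddf0 big1 // => s _; rewrite raddf0.
move=> _ _ /asboolP[a [b [-> b0 nab]]] /asboolP[a' [b' [-> b'0 nab']]].
apply/asboolP; exists (a - a'), (b - b'); split; rewrite ?raddfB //.
  by rewrite /= -b0 -b'0 subrr.
rewrite /is_norm raddfB /= nab nab' -sumrB.
by apply: eq_bigr => s _; rewrite raddfB.
Qed.
HB.instance Definition _ :=
  GRing.isZmodClosed.Build _ norm_ker norm_ker_zmod_closed.

Record relCl := RelCl { relCl_val :> Cl K; _ : relCl_val \in norm_ker }.
HB.instance Definition _ := [isSub for relCl_val].
HB.instance Definition _ := [Choice of relCl by <:].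
HB.instance Definition _ := [SubChoice_isSubZmodule of relCl by <:].

Definition gal_Cl s (c : Cl K) : Cl K :=
  \pi_(Cl K)%qT (gal_fracideal s (generic_quotient.repr c)).

Lemma gal_ClE s a : gal_Cl s (\pi_(Cl K)%qT a) = \pi_(Cl K)%qT (gal_fracideal s a).
Proof.
apply/eqP; rewrite -Quotient.idealrBE -raddfB.
have : generic_quotient.repr (\pi_(Cl K)%qT a) - a \in @principal K.
  by rewrite Quotient.idealrBE reprK.
case/asboolP=> x [Kx x0 xE]; apply/asboolP; exists (s x).
split; [exact: memv_gal | by rewrite fmorph_eq0 |].
transitivity [set s z | z in [set x * y | y in ring_int K]].
  by rewrite -xE.
apply/seteqP; split.
  move=> _ [_ [y Oy <-] <-]; exists (s y); rewrite ?rmorphM //.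
  exact: ring_int_gal.
rewrite -{1}(gal_ring_int s) => _ [_ [z Oz <-] <-].
by exists (x * z); rewrite ?rmorphM //; exists z.
Qed.

Fact gal_Cl_zmod_morphism s : zmod_morphism (gal_Cl s).
Proof.
move=> c d; rewrite -[c]reprK -[d]reprK.
by rewrite -[in LHS]raddfB !gal_ClE !raddfB.
Qed.
HB.instance Definition _ s := GRing.isZmodMorphism.Build _ _
  (gal_Cl s) (gal_Cl_zmod_morphism s).

Lemma gal_fracidealM s t a :
  gal_fracideal (s * t)%g a = gal_fracideal t (gal_fracideal s a).
Proof.
have [[aK _ _ _] _] := fracidealP a.
have E x : fracideal_set a x -> (s * t)%g x = t (s x).
  by move=> /aK Kx; rewrite galM.
apply: fracideal_inj; apply/seteqP; split=> /= [_ [x ax <-]|_ [_ [x ax <-] <-]].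
  by exists (s x); [exists x | rewrite E].
by exists x; rewrite ?E.
Qed.

Lemma gal_Cl_norm_ker s c : c \in norm_ker -> gal_Cl s c \in norm_ker.
Proof.
have Gs : s \in 'Gal(K / 1)%g by rewrite gal_kHom ?sub1v // k1HomE ahomWin.
case/asboolP=> a [b [-> b0 nab]]; apply/asboolP.
exists (gal_fracideal s a), b; split=> //; first by rewrite gal_ClE.
rewrite /is_norm nab (reindex_inj (mulgI s)) /=.
by apply: eq_big => [t|t _]; rewrite ?groupMl // gal_fracidealM.
Qed.

Definition gal_relCl s (c : relCl) : relCl :=
  RelCl (gal_Cl_norm_ker s (valP c)).

Fact gal_relCl_zmod_morphism s : zmod_morphism (gal_relCl s).
Proof. by move=> c d; apply: val_inj; rewrite /= !raddfB. Qed.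
HB.instance Definition _ s := GRing.isZmodMorphism.Build _ _
  (gal_relCl s) (gal_relCl_zmod_morphism s).

Definition act_relCl_pquot (p : nat) (c : pquot relCl p) (s : gal_of K) :
  pquot relCl p := pquot_map (gal_relCl s) c.

Fact act_relCl_pquot1 (p : nat) (c : pquot relCl p) :
  act_relCl_pquot c 1%g = c.
Proof.
rewrite -[c]reprK /act_relCl_pquot pquot_mapE; congr (\pi_(_)%qT _).
move: (generic_quotient.repr c) => d; apply: val_inj => /=.
rewrite -[d : Cl K]reprK gal_ClE; congr (\pi_(_)%qT _).
move: (generic_quotient.repr _) => a.
have [[aK _ _ _] _] := fracidealP a.
apply: fracideal_inj; apply/seteqP; split=> /= [_ [x ax <-]|x ax].
  by rewrite gal_id.
by exists x; rewrite ?gal_id.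
Qed.

Fact act_relCl_pquotM (p : nat) (c : pquot relCl p) :
  act_morph (@act_relCl_pquot p) c.
Proof.
move=> s t; rewrite -[c]reprK /act_relCl_pquot.
rewrite (pquot_mapE p (gal_relCl s)) !pquot_mapE.
congr (\pi_(_)%qT _); move: (generic_quotient.repr c) => d; apply: val_inj => /=.
by rewrite -[relCl_val d]reprK (gal_ClE s) !gal_ClE gal_fracidealM.
Qed.

(* The representation Gal(K/F) -> Aut(Cl(K/F)/Cl(K/F)^p), as a right action
   because products in gal_of K compose from left to right. *)
Canonical relCl_pquot_action p :=
  TotalAction (@act_relCl_pquot1 p) (@act_relCl_pquotM p).

End Galois.
End ClassGroup.

(* The smallest subfield of E containing the values of the character of rG;
   in characteristic p every subfield contains F_p. *)
Definition char_field (gT : finGroupType) (G : {group gT}) (E : fieldType)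
    (n : nat) (rG : mx_representation E G n) : set E :=
  [set x | forall S : {pred E}, GRing.divring_closed S ->
     {in G, forall g, \tr (rG g) \in S} -> x \in S].

(* Main.v *)
(** Let H be a nontrivial normal subgroup of Gamma, with fixed field K. For a
    class c of Cl(L/F), the product of the conjugates of c under H is the
    extension of a class of Cl(K/F), whose order is prime to p because class
    groups are torsion and Cl_p(K/F) = 1. Hence multiplication by #H, which is
    bijective on V = Cl(L/F)/p or Cl_p(L)/p, kills the H-invariants of V. So
    V^H = 0 for all such H: this is the faithfulness of V, and it forces every
    irreducible constituent of V over the splitting field E to be faithful,
    whence f divides dim V. The Frobenius x |-> x^p of E permutes the isotypic
    components of E (x) V and preserves their dimensions; if its k-th power
    fixes a component with character chi then chi^(p^k) = chi, so that r divides
    k. All orbits thus have length divisible by r, and rf divides dim V.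

    Relative norms of ideals are obtained as contents of norms of polynomials,
    by Gauss' lemma in the form of Dedekind and Mertens. *)

Require Import Defs.
From HB Require Import structures.
From mathcomp Require Import all_boot all_order all_algebra.
From mathcomp Require Import all_fingroup all_solvable all_field all_character.
From mathcomp Require Import boolp classical_sets.
From mathcomp Require Import zify ring lra ring_quotient.

Set Implicit Arguments.
Unset Strict Implicit.
Unset Printing Implicit Defensive.

Import GRing.Theory.
Local Open Scope ring_scope.

(** * Constituents after extension of scalars *)

(** The rows of [V] are the image of a basis of [U], hence a basis of [map_mx f U]. Rewriting them
    in the basis used by [submod_repr modUf] gives the intertwining matrix. *)
Lemma rsim_map_submod (aF rF : fieldType) (f : {rmorphism aF -> rF})
    (gT : finGroupType) (G : {group gT}) (n : nat)
    (rG : mx_representation aF G n) (rGf : mx_representation rF G n)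
    (U : 'M_n) (modU : mxmodule rG U) (modUf : mxmodule rGf (map_mx f U)) :
    {in G, forall x, rGf x = map_mx f (rG x)} ->
  mx_rsim (map_repr f (submod_repr modU)) (submod_repr modUf).
Proof.
move=> rGfE; pose V := map_mx f (val_submod (1%:M : 'M_(\rank U))).
have VE : (V :=: map_mx f U)%MS.
  by apply/map_eqmx; apply: val_submod1.
have sVU : (V <= map_mx f U)%MS by rewrite VE.
exists (in_submod _ V) => [||x Gx]; first by rewrite mxrank_map.
  by rewrite /row_free mxrank_in_submod // VE mxrank_map.
have -> : submod_repr modUf x = submod_mx modUf x by [].
rewrite -in_submodJ // rGfE // /V -map_mxM.
have := val_submodJ modU 1%:M Gx; rewrite mul1mx => <-.
by rewrite [val_submod (submod_mx _ _)]val_submodE map_mxM in_submodE mulmxA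
           -in_submodE.
Qed.

Lemma map_sumsmx_sub (aF rF : fieldType) (f : {rmorphism aF -> rF})
    (I : finType) (P : pred I) (m n : nat) (A : I -> 'M[aF]_n) (B : 'M[rF]_(m, n)) :
    (forall i, P i -> (map_mx f (A i) <= B)%MS) ->
  (map_mx f (\sum_(i | P i) A i)%MS <= B)%MS.
Proof.
move=> sAB; apply: (big_ind (fun C => map_mx f C <= B)%MS) => //.
  by rewrite map_mx0 sub0mx.
by move=> C D sC sD; rewrite map_addsmx addsmx_sub sC.
Qed.

Section Components.
Variables (F : fieldType) (gT : finGroupType) (G : {group gT}) (n : nat).
Variable rG : mx_representation F G n.

(** A component is a sum of isomorphic copies of [U], and a subfamily of these copies has the same
    sum and is direct. *)
Lemma mxrank_component_dvd U :
  mxsimple rG U -> (\rank U %| \rank (component_mx rG U))%N.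
Proof.
move=> simU; have [I [W isoW ->]] := component_mx_def simU.
have simW i : mxsimple rG (W i) by apply: mx_iso_simple simU.
have [J [defJ /mxdirectP dxJ]] := sum_mxsimple_direct_sub simW (eqmx_refl _).
rewrite -defJ dxJ /=; apply: dvdn_sum => i _.
by rewrite -(mxrank_iso (isoW i)).
Qed.

Lemma sum_rank_socle (sG : socleType rG) :
  ([pchar F]^'.-group G)%g -> (\sum_(W : sG) \rank W)%N = n.
Proof.
move=> /(mx_Maschke_pchar rG)/(reducible_Socle1 sG) S1.
by have /mxdirectP/= <- := Socle_direct sG; rewrite -/(Socle sG) S1 mxrank1.
Qed.

(** The kernel of the action on [U] is normal in [G]. If it were nontrivial, [U] would consist of
    vectors fixed by it and so vanish. *)
Lemma normal_fix0_faithful U (modU : mxmodule rG U) :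
    (forall H : {group gT}, (H <| G)%g -> H != 1%G -> rfix_mx rG H = 0) ->
  U != 0 -> mx_faithful (submod_repr modU).
Proof.
move=> fix0; apply: contraR => nfaith.
have := fix0 _ (rker_normal (submod_repr modU)).
rewrite -val_eqE /= finset.eqEsubset sub1G andbT => /(_ nfaith) fixK0.
rewrite -submx0 -fixK0; apply/rfix_mxP => x; rewrite rker_submod.
by case/setIdP=> _ /eqP.
Qed.

End Components.

(** * Frobenius as a permutation of the isotypic components *)

Section FrobeniusTwist.
Variables (p : nat) (E : fieldType) (pcharE : p \in [pchar E]).
Variables (gT : finGroupType) (G : {group gT}) (n : nat).
Variable rG : mx_representation E G n.
Local Notation phi := (pFrobenius_aut pcharE).
(** The matrix entries lie in the prime field, so that [map_mx phi] sends submodules to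
    submodules. *)
Hypothesis rG_phi : {in G, forall x, rG x = map_mx phi (rG x)}.

Lemma frob_module m (U : 'M_(m, n)) :
  mxmodule rG U -> mxmodule rG (map_mx phi U).
Proof.
move=> /mxmoduleP modU; apply/mxmoduleP => x Gx.
by rewrite rG_phi // -map_mxM map_submx modU.
Qed.

Lemma frob_iso (U V : 'M_n) :
  mx_iso rG U V -> mx_iso rG (map_mx phi U) (map_mx phi V).
Proof.
case=> f uf homf defV; exists (map_mx phi f); first by rewrite map_unitmx.
  apply/hom_mxP=> x Gx; rewrite rG_phi // -!map_mxM.
  by rewrite (hom_mxP homf).
by rewrite -map_mxM; apply/map_eqmx.
Qed.

Hypotheses (coG : ([pchar E]^'.-group G)%g) (splitG : group_splitting_field E G).

(** Since [phi] need not be onto, a submodule of the twist need not come from one of [U]. Absolute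
    irreducibility, which the splitting field provides, does pass through [phi]. *)
Lemma frob_simple U : mxsimple rG U -> mxsimple rG (map_mx phi U).
Proof.
move=> simU; have modU := mxsimple_module simU.
have modUf := frob_module modU.
apply/(submod_mx_irr modUf)/mx_abs_irrW.
rewrite -(mx_rsim_abs_irr (rsim_map_submod modU modUf rG_phi)) map_mx_abs_irr.
exact/splitG/submod_mx_irr.
Qed.

Variable sG : socleType rG.

Definition frob_socle (W : sG) : sG :=
  sval (Socle_iso sG (frob_simple (socle_simple W))).

Lemma frob_socle_iso W :
  mx_iso rG (socle_base (frob_socle W)) (map_mx phi (socle_base W)).
Proof. by rewrite /frob_socle; case: Socle_iso. Qed.

Lemma frob_socle_trace W x : x \in G ->
  \tr (socle_repr (frob_socle W) x) = \tr (socle_repr W x) ^+ p.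
Proof.
move=> Gx; have modU := frob_module (socle_module W).
have/(mx_rsim_iso (socle_module _) modU)/mxtrace_rsim-> // := frob_socle_iso W.
have/mxtrace_rsim<- // := rsim_map_submod (socle_module W) modU rG_phi.
by rewrite map_reprE trace_map_mx.
Qed.

Lemma sub_frob_socle (W : sG) : (map_mx phi W <= frob_socle W)%MS.
Proof.
have [I [V isoV defW]] := component_mx_def (socle_simple W).
rewrite /socle_val defW; apply: map_sumsmx_sub => i _.
apply: (mx_iso_component (socle_simple _)).
exact: mx_iso_trans (frob_socle_iso W) (frob_iso (isoV i)).
Qed.

(** The image of the whole socle under [phi] still spans the space, and it lies in the components
    hit by [frob_socle]. Their ranks thus already add up to [n], and a missed component would push
    the total above [n]. *)
Lemma frob_socle_surj V : V \in codom frob_socle.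
Proof.
apply: contraT => nV; have := sum_rank_socle sG coG.
have /mxdirectP/= dxS := subSocle_direct (sG := sG) (mem (codom frob_socle)).
have: (1%:M <= \sum_(W : sG | W \in codom frob_socle) W)%MS.
  have /(reducible_Socle1 sG) <- := mx_Maschke_pchar rG coG.
  have E1 : map_mx phi (Socle sG) = Socle sG.
    by rewrite reducible_Socle1 ?map_mx1 //; apply: mx_Maschke_pchar.
  rewrite -E1; apply: map_sumsmx_sub => W _.
  apply: submx_trans (sub_frob_socle W) _.
  by rewrite (sumsmx_sup (frob_socle W)) ?codom_f.
move/mxrankS; rewrite mxrank1 dxS => le_n.
rewrite (bigID (mem (codom frob_socle))) /= => def_n.
have: (0 < \sum_(W : sG | W \notin codom frob_socle) \rank W)%N.
  by rewrite (bigD1 V) //= addn_gt0 lt0n mxrank_eq0 nz_socle.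
by rewrite lt0n -leqn0 -(leq_add2l (\sum_(W in codom frob_socle) \rank W)%N) addn0
           [X in ~~ (X <= _)%N]def_n => /negP[].
Qed.

Lemma frob_socle_inj : injective frob_socle.
Proof.
apply: in2T; apply/image_injP/eqP/eq_card => V.
by rewrite frob_socle_surj.
Qed.

(** [sub_frob_socle] gives an inequality for each component. As [frob_socle] is a permutation, both
    sides have the same sum, so equality holds throughout. *)
Lemma rank_frob_socle (W : sG) : \rank (frob_socle W) = \rank W.
Proof.
have le (W' : sG) : (\rank W' <= \rank (frob_socle W') ?= iff
              (\rank W' == \rank (frob_socle W')))%N.
  by apply: leqif_eq; rewrite -(mxrank_map phi) mxrankS // sub_frob_socle.
have [_] := leqif_sum (fun W' (_ : true) => le W').
rewrite [X in _ == X](eq_bigr (fun W => \rank (frob_socle W))) //.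
rewrite -[X in _ == X](reindex_inj (P := xpredT)
  (F := fun W : sG => \rank W) frob_socle_inj).
by rewrite eqxx => /esym/forallP/(_ W)/eqP.
Qed.

Lemma dvdn_rank_frob (r f : nat) :
    (forall W : sG, f %| \rank (socle_base W))%N ->
    (forall (W : sG) k, (0 < k)%N ->
       {in G, forall x, \tr (socle_repr W x) ^+ (p ^ k) = \tr (socle_repr W x)} ->
     (r %| k)%N) ->
  (r * f %| n)%N.
Proof.
move=> dvd_f dvd_r; rewrite -(sum_rank_socle sG coG).
pose s := perm frob_socle_inj.
have iter_tr W k x : x \in G ->
    \tr (socle_repr (iter k s W) x) = \tr (socle_repr W x) ^+ (p ^ k).
  move=> Gx; elim: k => [|k IHk]; first by rewrite expr1.
  by rewrite iterS permE frob_socle_trace // IHk -exprM expnSr.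
have iter_rank W k : \rank (iter k s W : sG) = \rank W.
  by elim: k => //= k IHk; rewrite permE rank_frob_socle.
rewrite (partition_big (porbit s) (mem (porbits s))) /=; last first.
  by move=> W _; apply: imset_f.
apply: dvdn_sum => _ /imsetP[W _ ->].
rewrite (eq_bigl (fun V => V \in porbit s W)); last first.
  by move=> V; rewrite eq_porbit_mem.
rewrite (eq_bigr (fun=> \rank W)); last first.
  move=> V; rewrite porbit_traject => /trajectP[k _ ->].
  exact: iter_rank.
rewrite sum_nat_const; apply: dvdn_mul; last first.
  exact: dvdn_trans (dvd_f W) (mxrank_component_dvd (socle_simple W)).
(* After as many steps as its orbit is long, [W] returns to itself, so the corresponding power of
   Frobenius fixes its character. *)
apply: (dvd_r W); first by rewrite lt0n card_porbit_neq0.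
by move=> x Gx; rewrite -iter_tr // iter_porbit.
Qed.

End FrobeniusTwist.

Section ExtendScalars.
Variables (p : nat) (E : fieldType) (gT : finGroupType) (G : {group gT}).
Hypotheses (p_pr : prime p) (pcharE : p \in [pchar E]).

Lemma dvdn_rank_faithful (n : nat) (rG : mx_representation 'F_p G n) (r f : nat) :
    ~~ (p %| #|G|)%N -> group_splitting_field E G ->
    (forall H : {group gT}, (H <| G)%g -> H != 1%G -> rfix_mx rG H = 0) ->
    (forall m (rE : mx_representation E G m),
       mx_irreducible rE -> mx_faithful rE -> (f %| m)%N) ->
    (forall m (rE : mx_representation E G m) k,
       mx_irreducible rE -> mx_faithful rE -> (0 < k)%N ->
       {in G, forall x, \tr (rE x) ^+ (p ^ k) = \tr (rE x)} -> (r %| k)%N) ->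
  (r * f %| n)%N.
Proof.
move=> p'G splitG fix0 dvd_f dvd_r.
(* [pPrimeCharType] equips [E] with its structure of ['F_p]-algebra, and [iota] is the embedding of
   the prime field. *)
pose iota : {rmorphism 'F_p -> pPrimeCharType pcharE} :=
  GRing.RMorphism.clone _ _ (in_alg (pPrimeCharType pcharE)) _.
pose rGE := map_repr (iota : {rmorphism 'F_p -> E}) rG.
have faithE U (modU : mxmodule rGE U) : U != 0 -> mx_faithful (submod_repr modU).
  apply: normal_fix0_faithful => H nHG nt_H.
  by rewrite -map_rfix_mx fix0 // map_mx0.
have rGE_phi : {in G, forall x, rGE x = map_mx (pFrobenius_aut pcharE) (rGE x)}.
  move=> x _; apply/matrixP => i j; rewrite !mxE.
  have iotaE a : iota a = (a : nat)%:R by rewrite -[in LHS](natr_Zp a) rmorph_nat.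
  by rewrite iotaE rmorph_nat.
have coG : ([pchar E]^'.-group G)%g.
  by rewrite /pgroup (eq_pnat _ (eq_negn (pcharf_eq pcharE))) p'natE.
have simW (sG : socleType rGE) (W : sG) := socle_simple W.
(* The decomposition into components exists only classically, which suffices for a boolean goal. *)
apply: (@socle_exists _ _ _ _ rGE) => sG.
apply: (dvdn_rank_frob (pcharE := pcharE) (rG := rGE) rGE_phi coG splitG (sG := sG)).
  move=> W; apply: (dvd_f _ (socle_repr W)); first exact/submod_mx_irr/simW.
  by apply: faithE; case: (simW _ W).
move=> W k k_gt0; apply: dvd_r => //; first exact/submod_mx_irr/simW.
by apply: faithE; case: (simW _ W).
Qed.

End ExtendScalars.

(** * Fixed points of Frobenius powers and the degree of a character field *)

Section FrobeniusPowers.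
Variables (p : nat) (E : fieldType).
Hypotheses (p_pr : prime p) (pcharE : p \in [pchar E]).

Lemma frob_fixed_divring k :
  GRing.divring_closed [pred x : E | x ^+ (p ^ k) == x].
Proof.
have pnat_k : ([pchar E].-nat (p ^ k))%N.
  by rewrite pnatX /= (eq_pnat _ (pcharf_eq pcharE)) pnat_id.
split=> [|x y|x y]; rewrite !inE; first by rewrite expr1n.
  by move=> /eqP xE /eqP yE; rewrite exprDn_pchar // exprNn_pchar // xE yE.
by move=> /eqP xE /eqP yE; rewrite exprMn exprVn xE yE.
Qed.

(** The values of [f] are roots of ['X^(p ^ k) - 'X], which has degree [p ^ k] because [0 < k]. *)
Lemma card_frob_fixed (I : finType) (f : I -> E) k : (0 < k)%N ->
  injective f -> (forall i, f i ^+ (p ^ k) = f i) -> (#|I| <= p ^ k)%N.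
Proof.
move=> k_gt0 inj_f fixf; pose q : {poly E} := 'X^(p ^ k) - 'X.
have szq : size q = (p ^ k).+1.
  rewrite size_polyDl ?size_polyXn // size_polyN size_polyX.
  by have := ltn_exp2l 0 k (prime_gt1 p_pr); rewrite k_gt0.
have nzq : q != 0 by rewrite -size_poly_gt0 szq.
have := max_poly_roots nzq (rs := codom f); rewrite szq size_map -cardE ltnS.
apply; last by rewrite map_inj_uniq ?enum_uniq.
apply/allP=> _ /codomP[i ->]; by rewrite rootE !hornerE fixf subrr.
Qed.

(** Fermat's argument: multiplication by a nonzero [x] permutes the nonzero elements of [S], so
    their product [P] equals [x ^+ (p ^ r).-1 * P]. *)
Lemma fp_dim_frob_fixed (S : set E) r x : has_fp_dim p S r ->
  (forall x y, S x -> S y -> S (x * y)) -> S x -> x ^+ (p ^ r) = x.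
Proof.
case=> f [inj_f rf] SM Sx; have Sf v : S (f v) by rewrite -rf; exists v.
have [->|nzx] := eqVneq x 0.
  by rewrite expr0n eqn0Ngt expn_gt0 prime_gt0.
have mulx v : {w | f w = x * f v}.
  by apply: cid; have := SM _ _ Sx (Sf v); rewrite -rf => -[w _ <-]; exists w.
pose g v := sval (mulx v); have fg v : f (g v) = x * f v by apply: svalP (mulx v).
have inj_g : injective g.
  by move=> v w /(congr1 f); rewrite !fg => /(mulfI nzx)/inj_f.
have f0 v : (f v == 0) = (v == 0) by rewrite -(raddf0 f) (inj_eq inj_f).
pose P := \prod_(v | v != 0) f v.
have nzP : P != 0 by rewrite prodf_seq_neq0; apply/allP=> v _; rewrite f0 implybb.
have : P = x ^+ (p ^ r).-1 * P.
  rewrite {1}/P (reindex_inj inj_g) /=.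
  rewrite (eq_bigl (fun v => v != 0)); last first.
    by move=> v; rewrite -(f0 (g v)) fg mulf_eq0 (negPf nzx) f0.
  rewrite (eq_bigr _ (fun v _ => fg v)) big_split prodr_const /= -/P.
  congr (x ^+ _ * _); 
  transitivity #|predC1 (0 : 'rV['F_p]_r)|; first exact: eq_card.
  by rewrite cardC1 card_mx card_Fp ?mul1n.
rewrite -{1}[P]mul1r => /(mulIf nzP) x1.
by rewrite -(prednK (n := p ^ r)) ?expn_gt0 ?prime_gt0 // exprS -x1 mulr1.
Qed.

(** The [r]-th and the [k]-th power of Frobenius fix every element of the character field, hence so
    does the power of exponent [k %% r]. If that exponent were positive, [card_frob_fixed] would
    allow at most [p ^ (k %% r)] elements, fewer than [p ^ r]. *)
Lemma char_field_dim_dvd (gT : finGroupType) (G : {group gT}) (n : nat)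
    (rG : mx_representation E G n) (r k : nat) :
    has_fp_dim p (char_field rG) r -> (0 < k)%N ->
    {in G, forall g, \tr (rG g) ^+ (p ^ k) = \tr (rG g)} ->
  (r %| k)%N.
Proof.
move=> dimr k_gt0 trk; set S := char_field rG in dimr.
have SM x y : S x -> S y -> S (x * y).
  move=> Sx Sy K clK trK; have [K1 KB KV] := clK.
  by rewrite -[y]invrK KV ?(Sx K) // -[y^-1]mul1r KV ?(Sy K).
have fixr x := @fp_dim_frob_fixed S r x dimr SM.
have fixk x : S x -> x ^+ (p ^ k) = x.
  move/(_ _ (frob_fixed_divring k)); rewrite inE => Sx; apply/eqP/Sx.
  by move=> g Gg; rewrite inE trk.
have [f [inj_f rf]] := dimr; have Sf v : S (f v) by rewrite -rf; exists v.
have fixqr x q : S x -> x ^+ (p ^ (q * r)) = x.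
  move=> Sx; elim: q => [|q IHq]; first by rewrite expr1.
  by rewrite mulSn expnD exprM fixr.
have fixt x : S x -> x ^+ (p ^ (k %% r)) = x.
  move=> Sx; rewrite -{2}[x]fixk // {2}(divn_eq k r) expnD exprM.
  by rewrite fixqr.
have [//|t_gt0] := posnP (k %% r); first by move/eqP.
have := card_frob_fixed t_gt0 inj_f (fun v => fixt _ (Sf v)).
rewrite card_mx card_Fp // mul1n leq_exp2l ?prime_gt1 //.
(* For [r = 0] one has [k %% r = k], which is not below [r]; but then [S] would be a single point,
   although it contains 0 and 1. *)
have [r0|r_gt0] := posnP r; last by rewrite leqNgt ltn_pmod.
suff /eqP: 0 = 1 :> E by rewrite eq_sym oner_eq0.
have S0 : S 0.
  by move=> K clK _; have [K1 KB _] := clK; rewrite -(subrr 1) KB.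
have S1 : S 1 by move=> K [].
move: S0 S1; rewrite -rf; case=> v _ <- [w _ <-]; congr (f _).
by apply/rowP=> i; have := ltn_ord i; rewrite {2}r0.
Qed.

End FrobeniusPowers.

(** * The module V/pV *)

Section Pquot.
Local Open Scope quotient_scope.
Variables (p : nat) (V : zmodType).
Hypothesis p_pr : prime p.

Lemma pquot_mulrp (c : pquot V p) : c *+ p = 0.
Proof.
rewrite -[c]reprK -raddfMn; apply/eqP.
rewrite -[X in _ == X](raddf0 (\pi_(pquot V p))) -Quotient.idealrBE subr0.
by apply/asboolP; exists (generic_quotient.repr c).
Qed.

Lemma pquot_mulrn_eq0 (c : pquot V p) m :
  ~~ (p %| m)%N -> c *+ m = 0 -> c = 0.
Proof.
rewrite -prime_coprime // => /eqP cop cm0.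
have m_gt0 : (0 < m)%N.
  by case: m cop {cm0} => //; rewrite gcdn0 => p1; move: p_pr; rewrite p1.
have [u v def1 _] := egcdnP p m_gt0.
rewrite gcdnC cop in def1.
have : c *+ (u * m) = c.
  by rewrite def1 mulrnDr mulnC mulrnA pquot_mulrp mul0rn add0r.
by rewrite mulnC mulrnA cm0 mul0rn.
Qed.

Lemma Fp_scale_mulrn (U : lmodType 'F_p) (a : 'F_p) (u : U) :
  a *: u = u *+ (a : nat).
Proof. by rewrite -[in LHS](natr_Zp a) scaler_nat. Qed.

Lemma additive_mulmx (n : nat) (f : {additive 'rV['F_p]_n -> 'rV['F_p]_n})
    (v : 'rV_n) :
  f v = v *m \matrix_i f (delta_mx 0 i).
Proof.
rewrite [in LHS](row_sum_delta v) raddf_sum mulmx_sum_row.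
apply: eq_bigr => i _; rewrite rowK.
by rewrite !Fp_scale_mulrn raddfMn.
Qed.

Section Representation.
Variables (gT : finGroupType) (G : {group gT}) (act : gT -> {additive V -> V}).
Hypothesis act1 : forall x, act 1%g x = x.
Hypothesis actM : {in G &, forall s t x, act (s * t)%g x = act t (act s x)}.

(** The action is transported along the coordinates [f]. Row vectors are multiplied by matrices on
    the right, in accordance with the order of composition in [actM]. *)
Lemma pquot_representation n : has_fp_dim p [set: pquot V p] n ->
  exists (rG : mx_representation 'F_p G n) (f : 'rV['F_p]_n -> pquot V p),
    [/\ zmod_morphism f, injective f
      & forall s v, s \in G -> f (v *m rG s) = pquot_map (act s) (f v)].
Proof.
case=> f [inj_f rf].
have surj c : {v | f v = c}.
  apply: cid; have : [set: pquot V p]%classic c by [].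
  by rewrite -rf => -[v _ <-]; exists v.
pose g c := sval (surj c); have fK c : f (g c) = c by apply: svalP (surj c).
have gK v : g (f v) = v by apply: inj_f; rewrite fK.
pose a s v := g (pquot_map (act s) (f v)).
have fa s v : f (a s v) = pquot_map (act s) (f v) by rewrite fK.
have aB s : zmod_morphism (a s).
  by move=> u v; apply: inj_f; rewrite raddfB !fa !raddfB.
pose aA s : {additive _ -> _} :=
  HB.pack (a s) (GRing.isZmodMorphism.Build _ _ _ (aB s)).
pose M s := \matrix_i aA s (delta_mx 0 i).
have aE s v : a s v = v *m M s := additive_mulmx (aA s) v.
have reprM : mx_repr G M.
  split=> [|s t Gs Gt]; apply/row_matrixP => i; rewrite !rowE ?mulmxA -!aE.
    apply: inj_f; rewrite fa mulmx1 -[f _]reprK pquot_mapE.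
    by rewrite act1.
  apply: inj_f; rewrite !fa -[f (delta_mx 0 i)]reprK (pquot_mapE p (act s)).
  by rewrite !pquot_mapE (actM Gs Gt).
exists (MxRepresentation reprM), f; split=> // [|s v Gs]; first exact: raddfB.
by rewrite -fa aE.
Qed.

Hypothesis p'G : ~~ (p %| #|G|)%N.
(** The arithmetic input: for class groups it comes from the fixed field of [H]. *)
Hypothesis norm_prime_to_p : forall (H : {group gT}) (x : V),
  (H <| G)%g -> H != 1%G ->
  exists2 m, ~~ (p %| m)%N & (\sum_(h in H) act h x) *+ m = 0.

(** On a fixed class the sum over [H] is multiplication by [#|H|], so [c] is killed by [#|H| * m],
    which is prime to [p]. *)
Lemma pquot_fix0 (H : {group gT}) (c : pquot V p) :
    (H <| G)%g -> H != 1%G ->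
  (forall h, h \in H -> pquot_map (act h) c = c) -> c = 0.
Proof.
move=> nHG ntH fixc; have p'H : ~~ (p %| #|H|)%N.
  by apply: contra p'G => /dvdn_trans->//; rewrite cardSg ?normal_sub.
have [m p'm sum0] := norm_prime_to_p (generic_quotient.repr c) nHG ntH.
apply: (pquot_mulrn_eq0 (m := #|H| * m)).
  by rewrite Euclid_dvdM // negb_or p'H.
have := congr1 (\pi_(pquot V p)) sum0; rewrite raddf0 raddfMn raddf_sum => <-.
rewrite mulrnA -sumr_const.
congr (_ *+ m); apply: eq_bigr => h Hh; rewrite -{1}(fixc h Hh) -{1}[c]reprK.
by rewrite pquot_mapE.
Qed.

(** The alternative [r = 1%N] lets one statement yield both divisibility by [f] and divisibility by
    [r * f]. *)
Lemma prank_dvd (E : fieldType) (r f : nat) :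
    p \in [pchar E] -> group_splitting_field E G ->
    (forall n (rG : mx_representation E G n),
       mx_irreducible rG -> mx_faithful rG -> (f %| n)%N) ->
    (forall n (rG : mx_representation E G n),
       mx_irreducible rG -> mx_faithful rG ->
       r = 1%N \/ has_fp_dim p (char_field rG) r) ->
  (r * f %| prank p V)%N.
Proof.
move=> pcharE splitG dvd_f dvd_r; rewrite /prank.
(* If [V/pV] has no finite dimension, [prank] takes its default value 0, which everything
   divides. *)
case: xgetP => [n _ /= dimn|_]; last by rewrite dvdn0.
have [rG [g [gB inj_g gJ]]] := pquot_representation dimn.
apply: (dvdn_rank_faithful (rG := rG) p_pr pcharE p'G splitG) => //.
  move=> H nHG ntH; apply/eqP; rewrite -submx0; apply/row_subP => i.
  rewrite submx0; apply/eqP/inj_g.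
  have g0 : g 0 = 0 by rewrite -[0 in LHS](subrr 0) gB subrr.
  rewrite g0; apply: (pquot_fix0 nHG ntH) => h Hh.
  have Gh := fintype.subsetP (normal_sub nHG) h Hh; rewrite -gJ //.
  have /rfix_mxP/(_ h Hh) E1 := row_sub i (rfix_mx rG H).
  exact (congr1 g E1).
move=> n' rE k irr faith k_gt0 trk; have [->|dimr] := dvd_r _ _ irr faith.
  exact: dvd1n.
exact: char_field_dim_dvd dimr k_gt0 trk.
Qed.

End Representation.
End Pquot.

(** * The Dedekind-Mertens lemma *)

Section DedekindMertens.
Variable R : comNzRingType.
Implicit Types (f g : {poly R}) (S : R -> Prop) (s t : seq nat).

(** The monomials of degree [size s] in the coefficients; they generate the corresponding power of
    the content of [f]. *)
Definition coef_mon f s := \prod_(i <- s) f`_i.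

Definition add_closed S := [/\ S 0, forall x y, S x -> S y -> S (x + y)
  & forall x, S x -> S (- x)].

Lemma coef_mon_cons f i s : coef_mon f (i :: s) = f`_i * coef_mon f s.
Proof. by rewrite /coef_mon big_cons. Qed.

Lemma add_closed_mul S a : add_closed S -> add_closed (fun x => S (a * x)).
Proof.
case=> S0 SD SN; split=> [|x y|x]; rewrite ?mulr0 ?mulrDr ?mulrN //.
  exact: SD.
exact: SN.
Qed.

Lemma poly_top_split n f : (size f <= n.+1)%N ->
  exists2 f' : {poly R}, (size f' <= n)%N & f = f' + f`_n *: 'X^n.
Proof.
move=> szf; exists (take_poly n f); first exact: size_take_poly.
apply/polyP=> i; rewrite coefD coef_take_poly coefZ coefXn.
case: ltngtP => [lt_in|lt_ni|->]; rewrite ?mulr0 ?addr0 ?mulr1 ?add0r //.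
by rewrite nth_default // (leq_trans szf).
Qed.

Lemma coefMZXn f a n k :
  (f * (a *: 'X^n))`_k = a * (if (k < n)%N then 0 else f`_(k - n)).
Proof. by rewrite -scalerAr coefZ coefMXn. Qed.

Lemma top_coefM f g n m : (size f <= n.+1)%N -> (size g <= m.+1)%N ->
  (f * g)`_(n + m) = f`_n * g`_m.
Proof.
move=> szf szg; have lt_n : (n < (n + m).+1)%N by rewrite ltnS leq_addr.
rewrite coefM (bigD1 (Ordinal lt_n)) //= addKn big1 ?addr0 // => i ne_in.
have [lt_ni|le_in] := ltnP n i.
  by rewrite nth_default ?mul0r // (leq_trans szf).
rewrite [X in _ * X]nth_default ?mulr0 // (leq_trans szg) //.
have : (i != n :> nat)%N by []. lia.
Qed.

(* In terms of the content c(f), this is c(f)^(m+1) c(g) <= c(f)^m c(f g) for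
   g of degree at most m. *)
Lemma dedekind_mertens m S f g :
    add_closed S -> (size g <= m.+1)%N ->
    (forall s k, size s = m -> S (coef_mon f s * (f * g)`_k)) ->
  forall s j, size s = m.+1 -> S (coef_mon f s * g`_j).
Proof.
elim: m => [|m IHm] in S f g *.
  move=> clS szg Sfg [//|i [|//]] [|j] _; last first.
    by rewrite nth_default ?mulr0 //; [case: clS | apply: leq_trans szg _].
  have := Sfg [::] i erefl; rewrite coef_mon_cons /coef_mon !big_nil mulr1 mul1r.
  by rewrite [in f * g](size1_polyC szg) coefMC.
move=> clS szg Sfg; have [S0 SD SN] := clS.
have [g' szg' defg] := poly_top_split szg; set c := g`_m.+1 in defg.
(* Once the monomials times [c] are under control, the induction on the degree of [g] applies to
   [g'], since [f1 * g'] differs from [f1 * g] by a multiple of [c]. The factor [a] holds one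
   further coefficient in reserve. *)
have lower f1 a :
    (forall s k, size s = m -> S (a * (coef_mon f1 s * (f1 * g)`_k))) ->
    (forall s k, size s = m -> S (a * (coef_mon f1 (k :: s) * c))) ->
  forall s j, size s = m.+1 -> S (a * (coef_mon f1 s * g`_j)).
  move=> Sg Sc s j szs; rewrite defg coefD coefZ coefXn mulrDr mulrDr.
  apply: (SD); last first.
    case: eqP => _; rewrite ?mulr0 // mulr1.
    by case: s szs => // i s [szs]; apply: Sc.
  refine (IHm (fun x => S (a * x)) f1 g' (add_closed_mul _ clS) szg' _ s j szs).
  move=> t k szt; have -> : f1 * g' = f1 * g - f1 * (c *: 'X^(m.+1)).
    by rewrite defg mulrDr addrK.
  rewrite coefB coefMZXn !mulrBr; apply: (SD); first exact: Sg.
  apply: (SN); case: ltnP => _; first by rewrite !mulr0.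
  have := Sc t (k - m.+1)%N szt; rewrite coef_mon_cons.
  by congr (S _); ring.
(* The monomials times [c] are treated by a second induction, on the number of coefficients of
   [f1]. *)
have top n f1 : (size f1 <= n)%N ->
    (forall s k, size s = m.+1 -> S (coef_mon f1 s * (f1 * g)`_k)) ->
  forall s, size s = m.+2 -> S (coef_mon f1 s * c).
  elim: n f1 => [|n IHn] f1 szf Sf [//|i s] [szs].
    move: szf; rewrite size_poly_leq0 => /eqP->.
    by rewrite coef_mon_cons coef0 !mul0r.
  have [f' szf' deff] := poly_top_split szf.
  have mon0 t : n \in t -> coef_mon f' t = 0.
    move=> nt; rewrite /coef_mon (perm_big _ (perm_to_rem nt)) big_cons /=.
    by rewrite nth_default // mul0r.
  have mon_eq t : n \notin t -> coef_mon f1 t = coef_mon f' t.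
    move=> nt; apply: eq_big_seq => j jt; rewrite deff coefD coefZ coefXn.
    by case: eqP jt nt => [->->//|_ _ _]; rewrite mulr0 addr0.
  (* A factor of index [n] absorbs [c]: their product is the top coefficient of [f1 * g]. *)
  have top_in t : n \in t -> size t = m.+2 -> S (coef_mon f1 t * c).
    move=> nt szt; rewrite /coef_mon (perm_big _ (perm_to_rem nt)) big_cons /=.
    rewrite mulrAC -(top_coefM szf szg) mulrC; apply: Sf.
    by rewrite size_rem // szt.
  have [nt|nt] := boolP (n \in i :: s); first by apply: top_in; rewrite //= szs.
  rewrite mon_eq //; apply: IHn szf' _ _ _ => [t k szt|]; last by rewrite /= szs.
  have [nt'|nt'] := boolP (n \in t); first by rewrite mon0 // mul0r.
  (* Removing the top term of [f1] costs a correction with a factor of index [n]; with that factor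
     as [a], the monomials that [lower] asks for contain the index [n]. *)
  have -> : f' * g = f1 * g - g * (f1`_n *: 'X^n).
    by rewrite [in f1 * g]deff mulrDl [g * _]mulrC addrK.
  rewrite coefB coefMZXn mulrBr -mon_eq //; apply: (SD); first exact: Sf.
  apply: (SN); case: ltnP => _; first by rewrite !mulr0.
  rewrite mulrCA; apply: (lower) => // u j szu; rewrite mulrA -coef_mon_cons.
    by apply: (Sf); rewrite /= szu.
  by apply: top_in; rewrite /= ?szu // inE eqxx.
move=> [//|i s] j [szs]; rewrite coef_mon_cons -mulrA.
apply: (lower) => // u k szu; rewrite mulrA -coef_mon_cons.
  by apply: Sfg; rewrite /= szu.
by apply: (top _ _ (leqnn _) Sfg); rewrite /= szu.
Qed.

(* The polynomials f and sum_i b_i X^i have inverse contents: cancel the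
   monomials of Dedekind-Mertens against those in the b_i. *)
Lemma gauss_content (O S : R -> Prop) f g (b : nat -> R) :
    \sum_(i < size f) f`_i * b i = 1 ->
    (forall i j, O (f`_i * b j)) ->
    add_closed S -> (forall a x, O a -> S x -> S (a * x)) ->
    (forall k, S (f * g)`_k) ->
  forall i j, S (f`_i * g`_j).
Proof.
move=> fb1 Ofb clS SO Sfg i j; have [S0 SD SN] := clS.
pose bmon t := \prod_(k <- t) b k.
(* This amounts to multiplying [x] by the [n]-th power of the relation [fb1]. *)
have cancel n x : (forall s t, size s = n -> size t = n ->
    S (coef_mon f s * bmon t * x)) -> S x.
  elim: n x => [|n IHn] x Sx.
    by have := Sx [::] [::] erefl erefl; rewrite /coef_mon /bmon !big_nil !mul1r.
  rewrite -[x]mul1r -fb1 mulr_suml; apply: big_ind => // k _.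
  apply: IHn => s t szs szt; have := Sx (val k :: s) (val k :: t).
  rewrite /= szs szt => /(_ erefl erefl); rewrite coef_mon_cons /bmon big_cons.
  by congr (S _); ring.
have SM s t x : size s = size t -> S x -> S (coef_mon f s * bmon t * x).
  elim: s t x => [|k s IHs] [|l t] x //=.
    by rewrite /coef_mon /bmon !big_nil !mul1r.
  move=> [szst] Sx.
  have -> : coef_mon f (k :: s) * bmon (l :: t) * x =
            f`_k * b l * (coef_mon f s * bmon t * x).
    by rewrite coef_mon_cons /bmon big_cons; ring.
  by apply: SO => //; apply: IHs.
apply: (cancel (size g)) => s t szs szt.
pose S' x := forall u, size u = size g -> S (bmon u * x).
have clS' : add_closed S'.
  split=> [u|x y Sx Sy u szu|x Sx u szu]; rewrite ?mulr0 ?mulrDr ?mulrN //.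
    by apply: (SD); [apply: Sx | apply: Sy].
  exact/SN/Sx.
(* The resulting monomials in [f] have degree [size g + 1]. The monomials in [b] cancel [size g] of
   the factors, and the one of index [i] is left. *)
have := @dedekind_mertens (size g) S' f g clS' (leqnSn _) _ (i :: s) j.
rewrite /= szs => /(_ _ erefl t szt); rewrite coef_mon_cons.
have -> : bmon t * (f`_i * coef_mon f s * g`_j) =
          coef_mon f s * bmon t * (f`_i * g`_j).
  by ring.
by apply=> u k szu v szv; rewrite mulrCA mulrA; apply: SM; rewrite ?szu.
Qed.
End DedekindMertens.

(** * Relative norms of fractional ideals *)

Section Content.
Local Open Scope classical_set_scope.
Local Open Scope ring_scope.
Variables (F : fieldExtType rat) (L : splittingFieldType F).
Implicit Types (K : {subfield L}) (I J : set L).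
Local Notation E := {:L}%AS.

Lemma is_submod_addclosed K I : is_submod K I -> add_closed I.
Proof.
case=> [IK I0 ID IM]; split=> // x Ix; rewrite -mulN1r.
by apply: IM => //; apply/ring_intN/ring_int1.
Qed.

Lemma is_submod_sum K I (T : Type) (r : seq T) (P : pred T) (G : T -> L) :
  is_submod K I -> (forall t, P t -> I (G t)) -> I (\sum_(t <- r | P t) G t).
Proof. by case=> [_ I0 ID _] IG; apply: big_ind. Qed.

Lemma ring_intM K x y : ring_int K x -> ring_int K y -> ring_int K (x * y).
Proof. by have [_ _ _] := ring_int_submod K; apply. Qed.

Lemma ring_int_full K x : ring_int K x -> ring_int E x.
Proof. by case=> _ ix; split; first exact: memvf. Qed.

Lemma is_submod_field K : is_submod K [set x | x \in K].
Proof.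
split=> //= [|x y|a x [Ka _]]; [exact: mem0v | exact: rpredD |].
exact: rpredM.
Qed.

Lemma idealM_full_submod K I : is_submod K I -> is_submod E (idealM I (ring_int E)).
Proof.
move=> [IK I0 ID IM]; split=> [y _|||a y Oa] /=.
- exact: memvf.
- exact: idealM0.
- exact: idealMD.
move: y; apply: (@idealM_min _ _ _ _ [set y | idealM I (ring_int E) (a * y)]).
- by rewrite /= mulr0; apply: idealM0.
- by move=> u v /= ? ?; rewrite mulrDr; apply: idealMD.
- move=> u v fu Ov /=; rewrite mulrCA; apply: idealM_mul => //.
  exact: ring_intM.
Qed.

(** If a coefficient lies outside [K], no submodule of [K] contains all of them and the content is
    all of [L]; hence the condition on coefficients in [content_submod]. *)
Definition content K (f : {poly L}) : set L :=
  [set x | forall I, is_submod K I -> (forall i, I f`_i) -> I x].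

Lemma content_submod K (f : {poly L}) :
  (forall i, f`_i \in K) -> is_submod K (content K f).
Proof.
move=> Kf; split=> [x fx|I [] //|x y fx fy I sI If|a x Oa fx I sI If].
- exact: fx (is_submod_field K) Kf.
- by have [_ _ ID _] := sI; apply: ID; [apply: fx | apply: fy].
- by have [_ _ _ IM] := sI; apply: IM => //; apply: fx.
Qed.

Lemma content_full_submod f : is_submod E (content E f).
Proof. by apply: content_submod => i; apply: memvf. Qed.

Lemma mem_content K (f : {poly L}) i : content K f f`_i.
Proof. by move=> I _; apply. Qed.

Lemma content_ext K (f : {poly L}) : (forall i, f`_i \in K) ->
  idealM (content K f) (ring_int E) = content E f.
Proof.
move=> Kf; have [fE f0 fD fM] := content_full_submod f; apply/seteqP; split.
  apply: idealM_min => // x y fx Oy; rewrite mulrC; apply: (fM) => //.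
  suff [] : content E f x /\ x \in K by [].
  apply: (fx (fun x => content E f x /\ x \in K)) => [|i]; last first.
    by split; first exact: mem_content.
  split=> [z []//||u v [? ?] [? ?]|a u Oa [? ?]] /=.
  - by split=> //; apply: mem0v.
  - by split; [exact: fD | exact: rpredD].
  - split; first by apply: (fM) => //; apply: ring_int_full Oa.
    by case: Oa => Ka _; apply: rpredM.
move=> x; apply => [|i]; last first.
  rewrite -[_`_i]mulr1; apply: idealM_mul; first exact: mem_content.
  exact: ring_int1.
exact/idealM_full_submod/content_submod.
Qed.

(* Multiplying x in a by the first equation gives x = \sum_i A`_i * (b i * x),
   where b i * x is an integer. *)
Definition generates K (a : fracideal K) (A : {poly L}) (b : nat -> L) : Prop :=
  [/\ \sum_(i < size A) A`_i * b i = 1, forall i, (a : set L) A`_i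
    & forall j, ((- a : fracideal K) : set L) (b j)].

Lemma fracideal_submod K (a : fracideal K) : is_submod K a.
Proof. by have [] := fracidealP a. Qed.

Lemma fracideal_mulN K (a : fracideal K) x y :
  (a : set L) x -> ((- a : fracideal K) : set L) y -> ring_int K (x * y).
Proof.
by move=> ax ay; rewrite -fracideal0E -(subrr a) fracidealDE; apply: idealM_mul.
Qed.

Lemma ex_generates K (a : fracideal K) : exists A b, generates a A b.
Proof.
have: ((a - a : fracideal K) : set L) 1.
  by rewrite subrr fracideal0E; apply: ring_int1.
rewrite fracidealDE => -[s [s_a def1]].
have s0 i : (a : set L) (nth (0, 0) s i).1 /\
            ((- a : fracideal K) : set L) (nth (0, 0) s i).2.
  have [lt_is|le_si] := ltnP i (size s); first by apply: s_a; rewrite mem_nth.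
  rewrite nth_default //=.
  by split; [case: (fracideal_submod a) | case: (fracideal_submod (- a))].
exists (\poly_(i < size s) (nth (0, 0) s i).1), (fun i => (nth (0, 0) s i).2).
set A := \poly_(i < _) _; split=> [|i|j]; last by case: (s0 j).
  have szA : (size A <= size s)%N by apply: size_poly.
  rewrite [RHS]def1 (big_ord_widen _ (fun i => A`_i * (nth (0, 0) s i).2) szA).
  rewrite (big_nth (0, 0)) big_mkord big_mkcond /=; apply: eq_bigr => i _.
  have -> : (nth (0, 0) s i).1 = A`_i by rewrite coef_poly ltn_ord.
  by case: ltnP => // leAi; rewrite nth_default ?mul0r.
rewrite coef_poly; case: ifP => _; first by case: (s0 i).
by case: (fracideal_submod a).
Qed.

(** Gauss' lemma: the coefficients of [A] generate the invertible ideal [a], so [gauss_content]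
    recovers products of coefficients from the coefficients of the product. *)
Lemma content_genM (a : fracideal E) A b G : generates a A b ->
  content E (A * G) = idealM a (content E G).
Proof.
move=> [Ab1 aA ab]; have sa := fracideal_submod a.
have [_ C0 CD CM] := content_full_submod (A * G).
apply/seteqP; split.
  move=> x; apply.
    by apply: idealM_submod; last exact: content_full_submod.
  move=> k; rewrite coefM; apply: (is_submod_sum (K := E)).
    by apply: idealM_submod; last exact: content_full_submod.
  by move=> i _; apply: idealM_mul; last exact: mem_content.
apply: idealM_min => // x y ax Gy.
rewrite -[x]mul1r -Ab1 !mulr_suml.
apply: (is_submod_sum (K := E)); first exact: content_full_submod.
move=> i _; have -> : A`_i * b i * x * y = (x * b i) * (A`_i * y).
  by ring.
apply: (CM); first exact: fracideal_mulN (ab i).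
apply: (Gy (fun y => content E (A * G) (A`_i * y))).
  split=> [z _||u v Cu Cv|c u Oc Cu] /=.
  - exact: memvf.
  - by rewrite mulr0.
  - by rewrite mulrDr; apply: (CD).
  - by rewrite mulrCA; apply: (CM).
move=> j; apply: (gauss_content (O := ring_int E) Ab1).
- by move=> k l; apply: fracideal_mulN (aA k) (ab l).
- exact: is_submod_addclosed (content_full_submod _).
- by move=> c u; apply: (CM).
- by move=> k; apply: mem_content.
Qed.

Lemma content1 : content E 1 = ring_int E.
Proof.
have [OE O0 OD OM] := ring_int_submod E; apply/seteqP; split=> x.
  apply=> [|i]; first exact: ring_int_submod.
  by rewrite coef1; case: eqP => _; [apply: ring_int1 | apply: O0].
move=> Ox I [_ _ _ IM] /(_ 0%N); rewrite coef1 /= => I1.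
by rewrite -[x]mulr1; apply: IM.
Qed.

Lemma generates_gal (s : gal_of E) (a : fracideal E) A b :
  generates a A b -> generates (gal_fracideal s a) (map_poly s A) (s \o b).
Proof.
move=> [Ab1 aA ab]; split=> [|i|j].
- rewrite size_map_poly -(rmorph1 s) -Ab1 rmorph_sum; apply: eq_bigr => i _.
  by rewrite coef_map rmorphM.
- by rewrite coef_map; exists A`_i.
- by rewrite -raddfN; exists (b j).
Qed.

Lemma content_conj_prod (hs : seq (gal_of E)) (a : fracideal E) A b :
    generates a A b ->
  content E (\prod_(h <- hs) map_poly h A) =
  (\sum_(h <- hs) gal_fracideal h a : fracideal E).
Proof.
move=> genA; elim: hs => [|h hs IHhs]; first by rewrite !big_nil content1.
rewrite !big_cons fracidealDE -IHhs.
exact: content_genM (generates_gal h genA).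
Qed.

Section Descent.
Variables (K : {subfield L}) (H : {group gal_of E}).
Hypothesis fixH : forall x : L, (forall h, h \in H -> h x = x) <-> x \in K.

(** Write 1 as a sum of [y k * x k] with [y k] in [I], and multiply the conjugates of this equation
    under [H]. In the expansion the coefficient of each monomial in the [y k] is an integral element
    fixed by [H], hence lies in [ring_int K]. *)
Lemma ideal_descent1 I : is_submod K I -> I `<=` ring_int K ->
  idealM I (ring_int E) 1 -> I 1.
Proof.
move=> sI IO [s [sIO def1]]; have [IK I0 ID IM] := sI.
pose n := size s; pose y (k : 'I_n) := (nth (0, 0) s k).1.
pose x (k : 'I_n) := (nth (0, 0) s k).2.
have Iy k : I (y k) by case: (sIO _ (mem_nth (0, 0) (ltn_ord k))).
have Ox k : ring_int E (x k) by case: (sIO _ (mem_nth (0, 0) (ltn_ord k))).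
have Ky k h : h \in H -> h (y k) = y k.
  by move=> Hh; have /fixH -> := IK _ (Iy k).
pose T := subg_of H; pose g (h : T) := val h.
pose mon (phi : {ffun T -> 'I_n}) := \prod_h y (phi h).
pose X (phi : {ffun T -> 'I_n}) := \prod_h (g h) (x (phi h)).
have {def1} def1 : 1 = \sum_phi mon phi * X phi.
  transitivity (\prod_(h : T) (g h) 1).
    by rewrite big1 // => h _; rewrite rmorph1.
  transitivity (\prod_(h : T) \sum_(k < n) y k * (g h) (x k)).
    apply: eq_bigr => h _; rewrite def1 (big_nth (0, 0)) big_mkord rmorph_sum.
    by apply: eq_bigr => k _; rewrite rmorphM /= Ky ?subgP.
  rewrite bigA_distr_bigA; apply: eq_bigr => phi _.
  exact: big_split.
(* [J] is the finite set of values of the monomials; terms with equal value are collected. *)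
pose J := seq_sub (codom mon); pose q phi : J := SeqSub (codom_f mon phi).
have Imon phi : I (mon phi).
  rewrite /mon (bigD1 1%g) //= mulrC; apply: IM => //.
  apply: (big_ind (ring_int K)) => [|u v|h _]; [exact: ring_int1 | |exact: IO].
  exact: ring_intM.
rewrite def1 (partition_big q xpredT) //=.
apply: (is_submod_sum (K := K)) => // j _.
have -> : \sum_(phi | q phi == j) mon phi * X phi =
          val j * \sum_(phi | q phi == j) X phi.
  by rewrite big_distrr /=; apply: eq_bigr => phi /eqP <-.
have /codomP[phi0 ->] := valP j.
rewrite mulrC; apply: IM (Imon phi0); split; last first.
  apply: (big_ind (integralOver (intr : int -> L))); first exact: integral0.
    exact: integral_add.
  move=> phi _; apply: (big_ind (integralOver (intr : int -> L))).
  - exact: integral1.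
  - exact: integral_mul.
  - by move=> h _; have [_] := ring_int_gal (g h) (Ox (phi h)).
(* Translating the argument by [t] permutes the functions [phi] without changing their monomials. *)
apply/fixH => t Ht; rewrite rmorph_sum; pose t' : T := subg H t.
pose tr (phi : {ffun T -> 'I_n}) := [ffun h => phi (h * t')%g].
have tr_inj : injective tr.
  move=> phi psi /ffunP eq_tr; apply/ffunP => h; have := eq_tr (h * t'^-1)%g.
  by rewrite !ffunE mulgKV.
have mon_tr phi : mon (tr phi) = mon phi.
  rewrite /mon [RHS](reindex_inj (mulIg t')); apply: eq_bigr => h _.
  by rewrite ffunE.
rewrite [LHS](reindex_inj tr_inj) /=; apply: eq_big => [phi|phi _].
  by rewrite -!val_eqE /= mon_tr.
rewrite rmorph_prod [RHS](reindex_inj (mulIg t')); apply: eq_bigr => h _.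
rewrite ffunE -[LHS](@galM _ _ _ (g h) t) ?memvf // /g /=.
by rewrite subgK.
Qed.

End Descent.
End Content.

(** * Extension to [L], existence of the norm and its transitivity *)

Section Norm.
Local Open Scope classical_set_scope.
Local Open Scope ring_scope.
Variables (F : fieldExtType rat) (L : splittingFieldType F).
Implicit Types (K : {subfield L}) (I J : set L).
Local Notation E := {:L}%AS.

Section ExtFull.
Variable K : {subfield L}.
Implicit Types b c : fracideal K.

Lemma idealM_extE I J : idealM (idealM I (ring_int E)) (idealM J (ring_int E)) =
  idealM (idealM I J) (ring_int E).
Proof.
rewrite -idealMA (idealMA (ring_int E)) (idealMC (ring_int E)) -(idealMA J).
by rewrite (idealMO (ring_int_submod E)) idealMA.
Qed.

Lemma ring_int_extE : idealM (ring_int K) (ring_int E) = ring_int E.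
Proof.
apply/seteqP; split; last first.
  by move=> x Ox; rewrite -[x]mul1r; apply: idealM_mul => //; apply: ring_int1.
have [_ O0 OD OM] := ring_int_submod E.
by apply: idealM_min => // x y /ring_int_full Ox; apply: OM.
Qed.

Fact ext_full_fracideal b : is_fracideal E (idealM b (ring_int E)).
Proof.
split; first exact/idealM_full_submod/fracideal_submod.
exists (idealM (- b : fracideal K) (ring_int E)).
  exact/idealM_full_submod/fracideal_submod.
by rewrite idealM_extE -fracidealDE subrr fracideal0E ring_int_extE.
Qed.

Definition ext_full b : fracideal E := mk_fracideal (ext_full_fracideal b).

Fact ext_full_zmod_morphism : zmod_morphism ext_full.
Proof.
have D : {morph ext_full : b c / b + c}.
  by move=> b c; apply: fracideal_inj; rewrite fracidealDE /= idealM_extE.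
by move=> b c; apply: (addIr (ext_full c)); rewrite -D !subrK.
Qed.
HB.instance Definition _ := GRing.isZmodMorphism.Build _ _
  ext_full ext_full_zmod_morphism.

(** With generators [A] of [b] and dual elements [c], [x] is the sum of the terms [A_i * (c i * x)],
    where [c i * x] is integral and lies in [K]. *)
Lemma ext_full_contract b : (ext_full b : set L) `&` [set x | x \in K] `<=` b.
Proof.
move=> x [bx Kx]; have [A [c [Ac1 bA c_b]]] := ex_generates b.
rewrite -[x]mul1r -Ac1 mulr_suml; apply: (is_submod_sum (K := K)) => [|i _].
  exact: fracideal_submod.
rewrite -mulrA mulrC [c i * x]mulrC.
have [_ _ _ bM] := fracideal_submod b; apply: bM => //.
have [[cK _ _ _] _] := fracidealP (- b); split; first by rewrite rpredM // cK.
suff [] : ring_int E (x * c i) by [].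
apply: fracideal_mulN bx _; rewrite -raddfN -[c i]mulr1 /=.
by apply: idealM_mul => //; apply: ring_int1.
Qed.

Lemma ext_full_inj : injective ext_full.
Proof.
have sub b c : ext_full b = ext_full c -> (b : set L) `<=` c.
  move=> eq_bc x bx; apply: ext_full_contract; split.
    by rewrite -eq_bc -[x]mulr1 /=; apply: idealM_mul => //; apply: ring_int1.
  by have [[bK _ _ _] _] := fracidealP b; apply: bK.
by move=> b c eq_bc; apply/fracideal_inj/seteqP; split; apply: sub.
Qed.

Lemma ext_full_principal b :
  b \in @principal _ _ K -> ext_full b \in @principal _ _ E.
Proof.
move=> /asboolP[x [Kx nzx defb]]; apply/asboolP; exists x.
split=> //; first exact: memvf.
rewrite /= defb; have [_ O0 OD OM] := ring_int_submod E; apply/seteqP; split.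
  apply: idealM_min => [|_ _ [u Ou <-] [v Ov <-]|_ v [u Ou <-] Ov].
  - by exists 0; rewrite ?mulr0.
  - by exists (u + v); rewrite ?mulrDr //; apply: OD.
  - by exists (u * v); rewrite ?mulrA //; apply/OM/Ov/ring_int_full/Ou.
move=> _ [v Ov <-]; apply: idealM_mul => //.
by exists 1; rewrite ?mulr1 //; apply: ring_int1.
Qed.

End ExtFull.

Lemma ext_full_ext K (c : fracideal 1%AS) :
  ext_full (ext_fracideal K c) = ext_fracideal E c.
Proof. by apply: fracideal_inj; rewrite /= -idealMA ring_int_extE. Qed.

Lemma ext_full1 (c : fracideal 1%AS) : ext_full c = ext_fracideal E c.
Proof. exact: fracideal_inj. Qed.

Lemma gal_ext_full K (s : gal_of K) (g : gal_of E) (b : fracideal K) :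
  {in K, s =1 g} -> gal_fracideal g (ext_full b) = ext_full (gal_fracideal s b).
Proof.
move=> eq_sg; apply: fracideal_inj; rewrite /= gal_idealM gal_ring_int.
congr (idealM _ _); have [[bK _ _ _] _] := fracidealP b.
by apply/seteqP; split=> _ [x bx <-]; exists x; rewrite ?eq_sg //; apply: bK.
Qed.

(** The norm is the content over [K] of the product of the conjugates of a polynomial generating
    [a]. The same construction for [- a] provides its inverse. *)
Lemma ex_norm K (H : {group gal_of E}) (a : fracideal E) :
    (forall x : L, (forall h, h \in H -> h x = x) <-> x \in K) ->
  exists b : fracideal K, ext_full b = \sum_(h in H) gal_fracideal h a.
Proof.
move=> fixH; have [OE O0 OD OM] := ring_int_submod E.
pose N (A : {poly L}) := \prod_(h <- enum H) map_poly h A.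
have KN A i : (N A)`_i \in K.
  apply/fixH => t Ht.
  suff eqN : map_poly t (N A) = N A by rewrite -coef_map eqN.
  rewrite /N !big_enum rmorph_prod /= [RHS](reindex_inj (mulIg t)) /=.
  apply: eq_big => [h|h Hh]; first by rewrite groupMr.
  rewrite -map_poly_comp; apply: eq_map_poly => x /=.
  by rewrite galM ?memvf.
have contN (c : fracideal E) A b : generates c A b ->
    idealM (content K (N A)) (ring_int E) =
    (\sum_(h in H) gal_fracideal h c : fracideal E).
  move=> genA; rewrite (content_ext (KN A)).
  have -> : content E (N A) =
            (\sum_(h <- enum H) gal_fracideal h c : fracideal E).
    exact: content_conj_prod genA.
  by rewrite big_enum.
have [P [u genP]] := ex_generates a.
have [Q [v genQ]] := ex_generates (- a).
have NB : idealM (content K (N Q)) (ring_int E) =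
          (- \sum_(h in H) gal_fracideal h a : fracideal E).
  by rewrite (contN _ _ _ genQ) -sumrN; under eq_bigr do rewrite raddfN.
have sNA := content_submod (KN P); have sNB := content_submod (KN Q).
have [NAK _ _ _] := sNA; have [NBK _ _ _] := sNB.
(* The product of the two contents is integral and contains 1 after extension to [L], so
   [ideal_descent1] makes it the unit ideal. *)
have NAB : idealM (content K (N P)) (content K (N Q)) = ring_int K.
  have sNAB := idealM_submod sNA sNB; have [_ AB0 ABD ABM] := sNAB.
  have subO : idealM (content K (N P)) (content K (N Q)) `<=` ring_int K.
    have [_ ? ? _] := ring_int_submod K.
    apply: idealM_min => // x y NAx NBy; split.
      by rewrite rpredM //; [apply: NAK | apply: NBK].
    suff [] : ring_int E (x * y) by [].
    apply: (@fracideal_mulN _ _ _ (\sum_(h in H) gal_fracideal h a)).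
      by rewrite -(contN _ _ _ genP) -[x]mulr1; apply: idealM_mul (ring_int1 E).
    by rewrite -NB -[y]mulr1; apply: idealM_mul (ring_int1 E).
  apply/seteqP; split=> // x Ox; rewrite -[x]mulr1; apply: ABM => //.
  apply: (ideal_descent1 fixH) => //.
  rewrite -idealM_extE (contN _ _ _ genP) NB -fracidealDE subrr fracideal0E.
  exact: ring_int1.
have fracN : is_fracideal K (content K (N P)).
  by split; last by exists (content K (N Q)).
exists (mk_fracideal fracN); apply: fracideal_inj; exact: contN genP.
Qed.

Lemma galois_full K : galois K E.
Proof.
apply/and3P; split; [exact: subvf | | exact: normalFieldf].
apply/separableP => x _; apply: pcharf0_separable => q.
by rewrite (pchar_lalg L) (pchar_lalg F) Num.Theory.pchar_num.
Qed.

Lemma fix_gal_full K (x : L) :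
  (forall h, h \in 'Gal(E / K)%g -> h x = x) <-> x \in K.
Proof.
have /galois_fixedField fixK := galois_full K.
rewrite -{2}fixK; split=> [fixx|/mem_fixedFieldP[] //].
by apply/fixedFieldP; rewrite ?memvf.
Qed.

Lemma is_norm_full (a : fracideal E) (c : fracideal 1%AS) :
  is_norm a c <-> ext_full c = \sum_(g in 'Gal(E / 1)%g) gal_fracideal g a.
Proof. by rewrite ext_full1. Qed.

(** Extension to [L] is injective, so ideals of [L] may be compared. The fibres of the restriction
    from ['Gal(E / 1)] to ['Gal(K / 1)] are cosets of ['Gal(E / K)]. *)
Lemma is_norm_trans K (a : fracideal E) (b : fracideal K) (c : fracideal 1%AS) :
    normalField 1 K ->
    ext_full b = \sum_(h in 'Gal(E / K)%g) gal_fracideal h a ->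
  is_norm a c -> is_norm b c.
Proof.
move=> nK defb nac; apply: ext_full_inj; rewrite ext_full_ext nac raddf_sum /=.
have sub1KE : (1 <= K <= E)%VS by rewrite sub1v subvf.
have gal1E := galois_full 1%AS.
pose cast := normalField_cast K (E := E).
rewrite (partition_big cast (mem 'Gal(K / 1)%g)) /=; last first.
  move=> g Gg; rewrite -(normalField_img gal1E sub1KE nK).
  exact: mem_morphim.
apply: eq_bigr => s; rewrite -(normalField_img gal1E sub1KE nK).
case/morphimP => g Gg _ /= ->.
have sKG : 'Gal(E / K)%g \subset 'Gal(E / 1)%g by apply/galS/sub1v.
rewrite -(@gal_ext_full _ _ g); last first.
  by move=> x Kx; rewrite (normalField_cast_eq sub1KE nK Gg Kx).
rewrite defb raddf_sum (reindex_inj (mulIg g)) /=.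
apply: eq_big => [h|h _]; last by rewrite gal_fracidealM.
rewrite groupMr //; apply/andP/idP=> [[Gh /eqP eq_hg]|Hh].
  rewrite -(normalField_ker sub1KE nK); apply/kerP => //=.
  move: eq_hg; rewrite /cast (normalField_castM sub1KE nK) // => eq_hg.
  by apply: (mulIg (normalField_cast K g)); rewrite mul1g.
have Gh := fintype.subsetP sKG h Hh; split=> //.
move: Hh; rewrite -(normalField_ker sub1KE nK) => /kerP-/(_ Gh) /= h1.
by rewrite /cast (normalField_castM sub1KE nK) // h1 mul1g.
Qed.

End Norm.

(** * Ideal classes have finite order *)

Section Lattice.
Import Order.TTheory Num.Theory.

(** All powers of the denominator [b] divide [D]. If [b > 1], the exponent [D] is already a
    contradiction, since [D < b ^ D]. *)
Lemma rat_int_powers (r : rat) (D : nat) : (0 < D)%N ->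
  (forall k, r ^+ k * D%:R \is a Num.int) -> r \is a Num.int.
Proof.
move=> D_gt0 rD; set b := `|denq r|%N.
have b_gt0 : (0 < b)%N by rewrite absz_gt0 denq_neq0.
have dvdb k : (b ^ k %| D)%N.
  have /intrP[z def_z] := rD k.
  have: (denq r ^+ k %| numq r ^+ k * D%:Z)%Z.
    apply/dvdzP; exists z; apply: (@intr_inj rat).
    rewrite !rmorphM !rmorphXn /= -def_z -{2}[r]divq_num_den exprMn exprVn.
    rewrite -!mulrA [X in _ = _ * X]mulrCA mulVf ?mulr1 //.
    by rewrite expf_neq0 // intr_eq0 denq_neq0.
  rewrite dvdzE abszM !abszX Gauss_dvdr //.
  by apply: coprimeXl; apply: coprimeXr; rewrite coprime_sym coprime_num_den.
have [b_gt1|b_le1] := ltnP 1 b.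
  have := dvdn_leq D_gt0 (dvdb D).
  by rewrite leqNgt (leq_trans (ltn_expl D b_gt1)).
rewrite -[r]divq_num_den; have -> : denq r = 1.
  by rewrite -absz_denq; congr (_%:Z); apply/eqP; rewrite eqn_leq b_le1.
by rewrite divr1 intr_int.
Qed.

Variable K : fieldExtType rat.
Local Notation n := (\dim {:K}).
Local Notation intg := (integralOver (intr : int -> K)).

Lemma integral_multiple (x : K) : exists2 m, (0 < m)%N & intg (x *+ m).
Proof.
have [q mon_q qx0] := alg_integral x.
pose d := (size q).-1.
have [r [a nz_a def_q]] := rat_poly_scale q.
pose m := `|a|%N; have m_gt0 : (0 < m)%N by rewrite absz_gt0.
exists m => //; pose c := (m%:R : K).
(* [p] is the monic polynomial whose roots are those of [q] times [c]; below the top degree one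
   factor [c] clears the denominator of the coefficient. *)
pose p := \poly_(i < d.+1) ((q`_i)%:A * c ^+ (d - i)) : {poly K}.
have szq : size q = d.+1 by rewrite prednK // size_poly_gt0 monic_neq0.
have pE i : p`_i = if (i < d.+1)%N then (q`_i)%:A * c ^+ (d - i) else 0.
  by rewrite coef_poly.
have pd : p`_d = 1.
  rewrite pE ltnSn subnn mulr1; move/monicP: mon_q.
  by rewrite lead_coefE => ->; rewrite scale1r.
have szp : size p = d.+1.
  apply/eqP; rewrite eqn_leq size_poly /= ltnNge; apply/negP=> le_pd.
  by have/eqP := pd; rewrite nth_default // eq_sym oner_eq0.
apply: (@integral_root_monic _ _ _ _ p).
- by rewrite monicE lead_coefE szp /= pd.
- rewrite rootE horner_poly; apply/eqP.
  transitivity (c ^+ d * (map_poly (in_alg K) q).[x]); last first.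
    by rewrite (eqP qx0) mulr0.
  rewrite horner_coef size_map_poly szq mulr_sumr; apply: eq_bigr => i _.
  have -> : c ^+ d = c ^+ (d - i) * c ^+ i by rewrite -exprD subnK // -ltnS.
  by rewrite coef_map /= -mulr_natl exprMn -/c; ring.
- apply/integral_poly => i; rewrite pE; case: ltnP => [|_]; last exact: integral0.
  rewrite ltnS leq_eqVlt => /orP[/eqP->|lt_id].
    have := pd; rewrite pE ltnSn => ->; exact: integral1.
  rewrite -(subnSK lt_id) exprS mulrA; apply: integral_mul; last first.
    by rewrite -natrX; apply: integral_nat.
  have -> : (q`_i)%:A * c = (r`_i * Num.sg a)%:~R :> K.
    rewrite def_q coefZ coef_map /= -[c]scaler_nat -scalerAl mul1r scalerA.
    have -> : (m%:R : rat) = (Num.sg a * a)%:~R by rewrite -normrEsg -abszE.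
    transitivity (((r`_i * Num.sg a)%:~R : rat)%:A : K); last first.
      by rewrite scaler_int.
    congr (_ *: 1); rewrite !rmorphM /=; field.
    by rewrite intr_eq0.
  exact: integral_id.
Qed.

(** The [w i] form a basis over the rationals with coordinates [q]. Integral elements may have
    fractional coordinates, whose denominators [integral_bounded] controls. *)
Lemma integral_basis : exists (w : 'I_n -> K) (q : K -> 'I_n -> rat),
  [/\ forall i, intg (w i), forall x, x = \sum_i q x i *: w i,
      forall c x y i, q (c *: x + y) i = c * q x i + q y i
    & forall i j, q (w j) i = (i == j)%:R].
Proof.
pose v i := (vbasis {:K})`_i.
have /all_sig2[m m_gt0 int_m] i : {m | (0 < m)%N & intg (v i *+ m)}.
  by apply/cid2/integral_multiple.
pose M := (\prod_(i < n) m i)%N; have nzM : M%:R != 0 :> rat.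
  by rewrite pnatr_eq0 -lt0n prodn_gt0.
pose q (x : K) (i : 'I_n) : rat := coord (vbasis {:K}) i x / M%:R.
exists (fun i => v i *+ M), q; split=> [i|x|c x y i|i j].
- rewrite /M (bigD1 i) //= mulrnA -[_ *+ _]mulr_natr.
  by apply: integral_mul (int_m i) _; apply: integral_nat.
- rewrite [LHS](coord_vbasis (memvf x)); apply: eq_bigr => i _.
  by rewrite -scaler_nat scalerA divfK.
- by rewrite /q linearP mulrDl mulrA.
- rewrite /q raddfMn /= coord_free ?(basis_free (vbasisP _)) //.
  by rewrite -[_ *+ M]mulr_natr mulfK // eq_sym.
Qed.

Section IntegralBasis.
Variables (w : 'I_n -> K) (q : K -> 'I_n -> rat).
Hypothesis int_w : forall i, intg (w i).
Hypothesis wq : forall x, x = \sum_i q x i *: w i.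
Hypothesis qP : forall c x y i, q (c *: x + y) i = c * q x i + q y i.
Hypothesis qw : forall i j, q (w j) i = (i == j)%:R.

Let q0 i : q 0 i = 0.
Proof.
have := qP 1 0 0 i; rewrite scale1r addr0 mul1r => /(congr1 (fun t => t - q 0 i)).
by rewrite subrr addrK.
Qed.
Let qD x y i : q (x + y) i = q x i + q y i.
Proof. by rewrite -[x]scale1r qP mul1r scale1r. Qed.
Let qZ c x i : q (c *: x) i = c * q x i.
Proof. by rewrite -[c *: x]addr0 qP q0 addr0. Qed.
Let qB x y i : q (x - y) i = q x i - q y i.
Proof. by rewrite -scaleN1r addrC qP mulN1r addrC. Qed.
Let q_sum (I : Type) (r : seq I) (P : pred I) (f : I -> K) i :
  q (\sum_(j <- r | P j) f j) i = \sum_(j <- r | P j) q (f j) i.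
Proof. by apply: (big_morph (q^~ i)) => [x y|]; rewrite ?qD ?q0. Qed.
Let qMn x m i : q (x *+ m) i = q x i *+ m.
Proof. by rewrite -scaler_nat qZ mulr_natl. Qed.

Definition mulmat x : 'M[rat]_n := \matrix_(i, j) q (x * w i) j.
(** The field norm from [K] to the rationals. *)
Definition nrm x := \det (mulmat x).

Lemma mulmatM x y : mulmat (x * y) = mulmat x *m mulmat y.
Proof.
apply/matrixP => i j; rewrite !mxE -mulrA mulrCA [x * w i]wq mulr_sumr q_sum.
by apply: eq_bigr => k _; rewrite !mxE -scalerAr qZ.
Qed.

Lemma nrmM x y : nrm (x * y) = nrm x * nrm y.
Proof. by rewrite /nrm mulmatM det_mulmx. Qed.

Lemma nrm1 : nrm 1 = 1.
Proof.
rewrite /nrm (_ : mulmat 1 = 1%:M) ?det1 //; apply/matrixP => i j.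
by rewrite !mxE mul1r qw eq_sym.
Qed.

Lemma nrm_neq0 x : x != 0 -> nrm x != 0.
Proof.
move=> nzx; have : nrm x * nrm x^-1 = 1 by rewrite -nrmM mulfV ?nrm1.
by case: eqVneq => // ->; rewrite mul0r => /eqP; rewrite eq_sym oner_eq0.
Qed.

Lemma nrmX x k : nrm (x ^+ k) = nrm x ^+ k.
Proof. by elim: k => [|k IHk]; rewrite ?nrm1 // !exprS nrmM IHk. Qed.

Lemma det_int (A : 'M[rat]_n) (D : nat) :
  (forall i j, D%:R * A i j \is a Num.int) -> D%:R ^+ n * \det A \is a Num.int.
Proof.
move=> intA; rewrite -detZ /determinant; apply: rpred_sum => s _.
by rewrite rpredMsign; apply: rpred_prod => i _; rewrite mxE.
Qed.

Lemma ex_denominator (I : finType) (f : I -> rat) :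
  exists2 D, (0 < D)%N & forall i, D%:R * f i \is a Num.int.
Proof.
exists (\prod_i `|denq (f i)|)%N.
  by apply: prodn_gt0 => i; rewrite absz_gt0 denq_neq0.
move=> i; rewrite (bigD1 i) //= natrM mulrAC; apply: rpredM; last exact: rpred_nat.
have -> : (`|denq (f i)|%N%:R : rat) = (denq (f i))%:~R.
  by rewrite -[in RHS]absz_denq.
rewrite -{2}[f i]divq_num_den mulrCA mulfV ?mulr1 ?intr_int //.
by rewrite intr_eq0 denq_neq0.
Qed.

(** The monic equation of [x] reduces high powers to those below its degree, so a common denominator
    for finitely many elements serves for all. *)
Lemma bounded_powers x : intg x ->
  exists2 D, (0 < D)%N & forall k i j, D%:R * q (x ^+ k * w i) j \is a Num.int.
Proof.
case=> p mon_p px0; set px := map_poly _ _ in px0.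
pose d := (size p).-1; have szp : size p = d.+1.
  by rewrite prednK // size_poly_gt0 monic_neq0.
have [D D_gt0 intD] := ex_denominator
  (fun t : 'I_d * ('I_n * 'I_n) => q (x ^+ t.1 * w t.2.1) t.2.2).
exists D => //; elim/ltn_ind => k IHk i j.
have [lt_kd|le_dk] := ltnP k d; first exact: (intD (Ordinal lt_kd, (i, j))).
have xd : x ^+ d = - \sum_(l < d) (p`_l)%:~R * x ^+ l.
  have szpx : size px = d.+1.
    rewrite /px size_map_poly_id0 // (monicP mon_p) oner_neq0 //.
  move: px0; rewrite rootE horner_coef szpx big_ord_recr /= /px coef_map /=.
  have -> : p`_d = 1 by move/monicP: mon_p; rewrite lead_coefE szp.
  rewrite mul1r addrC addr_eq0 => /eqP->; congr (- _).
  by apply: eq_bigr => l _; rewrite coef_map.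
rewrite -(subnK le_dk) exprD xd mulrN mulNr mulr_sumr mulr_suml.
rewrite -scaleN1r qZ mulN1r mulrN rpredN q_sum mulr_sumr; apply: rpred_sum => l _.
have -> : x ^+ (k - d) * ((p`_l)%:~R * x ^+ l) * w i =
          (p`_l)%:~R *: (x ^+ (k - d + l) * w i).
  by rewrite scaler_int -mulrzl exprD; ring.
rewrite qZ mulrCA; apply: rpredM; first exact: intr_int.
by apply: IHk; have := ltn_ord l; lia.
Qed.

(** The powers of [nrm x] have the common denominator [D ^ n], so [rat_int_powers] applies. *)
Lemma nrm_int x : intg x -> nrm x \is a Num.int.
Proof.
case/bounded_powers=> D D_gt0 intD.
apply: (@rat_int_powers _ (D ^ n)) => [|k]; first by rewrite expn_gt0 D_gt0.
rewrite -nrmX natrX mulrC; apply: det_int => i j; rewrite mxE; exact: intD.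
Qed.

Lemma nrm_ge1 x : intg x -> x != 0 -> 1 <= `|nrm x|.
Proof. by move=> int_x nzx; rewrite norm_intr_ge1 ?nrm_int ?nrm_neq0. Qed.

Lemma nrm_small : exists m : nat, forall x,
  (forall i, `|q x i| * m.+1%:R < 1) -> `|nrm x| < 1.
Proof.
(* [C] bounds the entries of all multiplication matrices of the basis. Coordinates below [1 / M]
   then give entries at most [C / M] and a determinant at most [n! * (C / M) ^ n]. *)
pose C := \sum_(t : 'I_n * ('I_n * 'I_n)) `|mulmat (w t.1) t.2.1 t.2.2|.
have C_ge0 : 0 <= C by apply: sumr_ge0.
pose m := Num.bound (C * n`!%:R); exists m => x small_x.
set M := m.+1%:R in small_x; have M_gt0 : 0 < M by rewrite ltr0n.
have CM : C * n`!%:R < M.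
  by apply: lt_trans (archi_boundP _) _; rewrite ?mulr_ge0 // ltr_nat.
have le_mul i j : `|mulmat x i j| <= C / M.
  have -> : mulmat x i j = \sum_k q x k * mulmat (w k) i j.
    rewrite mxE {1}[x]wq mulr_suml q_sum; apply: eq_bigr => k _.
    by rewrite mxE -scalerAl qZ.
  apply: le_trans (ler_norm_sum _ _ _) _.
  apply: (@le_trans _ _ (\sum_k `|mulmat (w k) i j| / M)).
    apply: ler_sum => k _; rewrite normrM mulrC ler_wpM2l //.
    by rewrite -[M^-1]mul1r ler_pdivlMr // ltW.
  rewrite -mulr_suml ler_pM2r ?invr_gt0 //.
  rewrite /C -(pair_big xpredT xpredT (fun k ij => `|mulmat (w k) ij.1 ij.2|)) /=.
  by apply: ler_sum => k _; rewrite (bigD1 (i, j)) //= lerDl sumr_ge0.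
apply: (@le_lt_trans _ _ (n`!%:R * (C / M) ^+ n)).
  rewrite /nrm /determinant; apply: le_trans (ler_norm_sum _ _ _) _.
  rewrite -[n`!]card_Sn mulr_natl -sumr_const; apply: ler_sum => s _.
  rewrite normrM normrX normrN1 expr1n mul1r normr_prod.
  have -> : (C / M) ^+ n = \prod_(i < n) (C / M) by rewrite prodr_const card_ord.
  by apply: ler_prod => i _; rewrite normr_ge0 le_mul.
have n_gt0 : (0 < n)%N by apply: adim_gt0.
have fact_ge1 : 1 <= n`!%:R :> rat by rewrite ler1n fact_gt0.
have CM1 : C / M <= 1.
  rewrite ler_pdivrMr // mul1r; apply: le_trans (ltW CM).
  by rewrite -[X in X <= _]mulr1 ler_wpM2l.
apply: (@le_lt_trans _ _ (n`!%:R * (C / M))).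
  rewrite ler_wpM2l ?ler0n // -(prednK n_gt0) exprS.
  by rewrite ler_piMr ?exprn_ile1 ?divr_ge0 // ltW.
by rewrite mulrA ltr_pdivrMr // mul1r mulrC.
Qed.

(* Hurwitz: by the pigeonhole principle for the fractional parts of the
   coordinates of 0, x, 2x, ..., a bounded multiple of x is close to an
   integer. *)
Lemma hurwitz_approx : exists M : nat, forall x, exists t y,
  [/\ (0 < t <= M)%N, intg y, forall i, q y i \is a Num.int
    & `|nrm (x *+ t - y)| < 1].
Proof.
have [m small_m] := nrm_small; exists (m.+1 ^ n)%N => x.
pose fr k i := q (x *+ k) i - (Num.floor (q (x *+ k) i))%:~R.
have fr_ge0 k i : 0 <= fr k i by rewrite subr_ge0 floor_le.
have fr_lt1 k i : fr k i < 1.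
  by rewrite ltrBlDl -[1]/(1%:~R) -rmorphD floorD1_gt.
(* The unit cube is cut into [m.+1 ^ n] boxes of side [1 / m.+1], one fewer than the number of
   multiples considered. *)
pose box (k : 'I_(m.+1 ^ n).+1) :=
  [ffun i : 'I_n => inord (Num.truncn (fr k i * m.+1%:R)) : 'I_m.+1].
have boxE k i : box k i = Num.truncn (fr k i * m.+1%:R) :> nat.
  rewrite ffunE inordK // truncn_lt_nat ?mulr_ge0 //.
  by rewrite -[X in _ < X]mul1r ltr_pM2r ?ltr0n.
have [k [l [lt_kl eq_kl]]] :
    exists k l : 'I_(m.+1 ^ n).+1, (k < l)%N /\ box k = box l.
  have : ~~ injectiveb box.
    apply/negP => /injectiveP/leq_card; rewrite card_ffun !card_ord.
    by rewrite ltnn.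
  case/injectivePn => k [l ne_kl eq_kl].
  have [lt_kl|lt_lk|/val_inj eq'] := ltngtP k l.
  - by exists k, l.
  - by exists l, k.
  - by rewrite eq' eqxx in ne_kl.
pose z i := Num.floor (q (x *+ l) i) - Num.floor (q (x *+ k) i).
pose y := \sum_i (z i)%:~R *: w i.
have qy i : q y i = (z i)%:~R.
  rewrite q_sum (bigD1 i) //= qZ qw eqxx mulr1 big1 ?addr0 // => j ne_ji.
  by rewrite qZ qw eq_sym (negPf ne_ji) mulr0.
exists (l - k)%N, y; split=> [||i|].
- by have := ltn_ord l; lia.
- apply: (big_ind intg) => [||i _]; [exact: integral0 | exact: integral_add |].
  by rewrite scaler_int -mulrzl; apply: integral_mul => //; apply: integral_id.
- by rewrite qy intr_int.
apply: small_m => i; rewrite qB qy mulrnBr ?(ltnW lt_kl) // qB.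
have -> : q (x *+ l) i - q (x *+ k) i - (z i)%:~R = fr l i - fr k i.
  by rewrite /z rmorphB /= /fr; ring.
have /ffunP/(_ i)/(congr1 val)/= := eq_kl; rewrite !boxE => eq_box.
have m_gt0 : 0 < m.+1%:R :> rat by rewrite ltr0n.
have /andP[k1 k2] : (Num.truncn (fr k i * m.+1%:R))%:R <= fr k i * m.+1%:R <
    (Num.truncn (fr k i * m.+1%:R)).+1%:R by rewrite truncn_itv ?mulr_ge0.
have /andP[l1 l2] : (Num.truncn (fr l i * m.+1%:R))%:R <= fr l i * m.+1%:R <
    (Num.truncn (fr l i * m.+1%:R)).+1%:R by rewrite truncn_itv ?mulr_ge0.
rewrite -[X in _ * X]ger0_norm ?ler0n // -normrM mulrBl ltr_norml.
move: k1 k2 l1 l2; rewrite eq_box -!natr1; set T := (Num.truncn _)%:R.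
by move=> *; apply/andP; split; lra.
Qed.

(** For integral [x] the difference [x *+ t - y] of [hurwitz_approx] is integral of norm below 1,
    hence zero. So [t] clears the denominators of [x], and [t] divides [M!]. *)
Lemma integral_bounded : exists2 M, (0 < M)%N &
  forall x i, intg x -> M%:R * q x i \is a Num.int.
Proof.
have [M approx] := hurwitz_approx; exists M`!; first exact: fact_gt0.
move=> x i int_x; have [t [y [/andP[t_gt0 le_tM] int_y int_qy lt1]]] := approx x.
have int_d : intg (x *+ t - y).
  apply: integral_sub => //; rewrite -mulr_natr.
  by apply: integral_mul => //; apply: integral_nat.
have /eqP : x *+ t - y == 0.
  by apply: contraTT lt1 => nz; rewrite -leNgt nrm_ge1.
move/(congr1 (q^~ i)); rewrite q0 qB qMn => /eqP; rewrite subr_eq0 => /eqP eq_q.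
have /dvdnP[c ->] : (t %| M`!)%N by rewrite dvdn_fact // t_gt0.
rewrite natrM -mulrA [t%:R * _]mulr_natl eq_q; apply: rpredM; last exact: int_qy.
exact: rpred_nat.
Qed.

Definition is_ideal (A : K -> Prop) : Prop :=
  [/\ forall x y, A x -> A y -> A (x - y),
      forall a x, intg a -> A x -> A (a * x),
      exists2 x, A x & x != 0
    & exists2 a, a != 0 & forall x, A x -> intg (a * x)].

(** After multiplication by the common denominator [a] the absolute norms are natural numbers, so a
    least one exists. *)
Lemma ideal_min_norm (A : K -> Prop) : is_ideal A ->
  exists x, [/\ A x, x != 0 & forall y, A y -> `|nrm y| < `|nrm x| -> y = 0].
Proof.
case=> [AB AM [x0 Ax0 nzx0] [a nza intA]].
have [M M_gt0 intM] := integral_bounded.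
pose P k := `[< exists x, [/\ A x, x != 0 & `|nrm (a * x)| = k%:R] >].
have exP x : A x -> x != 0 -> exists2 k, P k & `|nrm (a * x)| = k%:R.
  move=> Ax nzx; have /intrP[z def_z] := nrm_int (intA x Ax).
  exists `|z|%N; last by rewrite def_z -intr_norm natr_absz.
  by apply/asboolP; exists x; split; rewrite // def_z -intr_norm natr_absz.
have exk : exists k, P k by have [k Pk _] := exP _ Ax0 nzx0; exists k.
case: (ex_minnP exk) => k /asboolP[x [Ax nzx def_k]] min_k.
exists x; split=> // y Ay; have [-> //|nzy] := eqVneq y 0.
have [l Pl def_l] := exP y Ay nzy; have := min_k l Pl.
rewrite -(ler_nat rat) -def_k -def_l !nrmM !normrM.
rewrite ler_pM2l ?normr_gt0 ?nrm_neq0 //.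
by rewrite leNgt => /negP.
Qed.

(** Take [x] of minimal norm in [A] and approximate [y / x] by [z / t]. Then [y *+ t - z * x] lies
    in [A] with smaller norm, so it vanishes. *)
Lemma ideal_almost_principal : exists2 M, (0 < M)%N & forall A, is_ideal A ->
  exists x, [/\ A x, x != 0 & forall y, A y -> intg (y / x *+ M)].
Proof.
have [M approx] := hurwitz_approx; exists M`!; first exact: fact_gt0.
move=> A idA; have [x [Ax nzx minx]] := ideal_min_norm idA.
have [AB AM _ _] := idA; exists x; split=> // y Ay.
have [t [z [/andP[t_gt0 le_tM] int_z _ lt1]]] := approx (y / x).
have : y *+ t - z * x = 0.
  apply: minx.
    apply: AB; last exact: AM.
    by rewrite -mulr_natl; apply: AM => //; apply: integral_nat.
  have -> : y *+ t - z * x = (y / x *+ t - z) * x.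
    by rewrite mulrBl -mulrnAl divfK.
  by rewrite nrmM normrM gtr_pMl ?normr_gt0 ?nrm_neq0.
move/eqP; rewrite subr_eq0 => /eqP def_y.
have /dvdnP[c ->] : (t %| M`!)%N by rewrite dvdn_fact // t_gt0.
rewrite mulnC mulrnA -mulrnAl def_y mulfK // -mulr_natr.
by apply: integral_mul => //; apply: integral_nat.
Qed.

(** Finiteness of the class number: each ideal is a multiple of one lying between [M] times the ring
    of integers and that ring, and there are finitely many of these. *)
Lemma ideal_class_pigeonhole (A : nat -> K -> Prop) :
  (forall k, is_ideal (A k)) ->
  exists i j c, [/\ (i < j)%N, c != 0 & forall x, A i x <-> A j (c * x)].
Proof.
move=> idA; have [M M_gt0 almost] := ideal_almost_principal.
have [D D_gt0 intD] := integral_bounded.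
have /choice[x xP] k := almost _ (idA k).
(* [B k] is [A k] scaled by [M / x k]; [intB] and [BM] place it between the integers and their
   multiples by [M]. *)
pose B k y := A k (y * x k / M%:R).
have nzM : M%:R != 0 :> K.
  by rewrite -scaler_nat scaler_eq0 oner_eq0 orbF pnatr_eq0 -lt0n.
have nzx k : x k != 0 by case: (xP k).
have BE k y : A k y <-> B k (y / x k * M%:R).
  by rewrite /B [_ * x k]mulrAC divfK // mulfK.
have intB k y : B k y -> intg y.
  case: (xP k) => _ _ int_k /int_k; congr (intg _).
  by rewrite -[_ *+ M]mulr_natr [_ / x k]mulrAC mulfK // divfK.
have BB k y z : B k y -> B k z -> B k (y - z).
  by rewrite /B !mulrBl; case: (idA k) => AB _ _ _; apply: AB.
have BM k a : intg a -> B k (a * M%:R).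
  move=> int_a; case: (idA k) => _ AM _ _; case: (xP k) => Ax _ _.
  by rewrite /B mulrAC mulfK //; apply: AM.
pose W := (D * M)%N; have W_gt0 : (0 < W)%N by rewrite muln_gt0 D_gt0.
pose res y i := (Num.floor (D%:R * q y i) %% W)%Z.
(* [D] makes the coordinates integers, so congruence modulo [W = D * M] means that the coordinates
   of [y - z] are integer multiples of [M]. *)
have res_eq y z : intg y -> intg z -> res y =1 res z ->
    exists2 a, intg a & y - z = a * M%:R.
  move=> int_y int_z eq_r.
  have /choice[c cP] i : exists c : int, q (y - z) i = c%:~R * M%:R.
    have : (Num.floor (D%:R * q y i) == Num.floor (D%:R * q z i) %[mod W])%Z.
      exact/eqP/eq_r.
    rewrite eqz_mod_dvd => /dvdzP[c def_c]; exists c.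
    have nzD : D%:R != 0 :> rat by rewrite pnatr_eq0 -lt0n.
    apply: (mulfI nzD); rewrite qB mulrBr -(floorK (intD y i int_y)).
    rewrite -(floorK (intD z i int_z)) -rmorphB def_c /W PoszM !rmorphM /=.
    by rewrite -!pmulrn; ring.
  exists (\sum_i (c i)%:~R *: w i).
    apply: (big_ind intg) => [||i _]; [exact: integral0 | exact: integral_add |].
    by rewrite scaler_int -mulrzl; apply: integral_mul => //; apply: integral_id.
  rewrite [LHS]wq mulr_suml; apply: eq_bigr => i _.
  by rewrite cP -scalerAl [w i * _]mulr_natr -[w i *+ M]scaler_nat scalerA.
pose T := {ffun 'I_n -> 'I_W}.
(* The set of residues of [B k] determines [B k], because [B k] is stable under adding multiples of
   [M]. *)
pose code k : {set T} :=
  [set v : T | `[< exists2 y, B k y & forall i, (v i)%:Z = res y i >]].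
have [i [j [lt_ij eq_code]]] : exists i j, (i < j)%N /\ code i = code j.
  pose codeI (k : 'I_(#|{set T}|).+1) := code k.
  have : ~~ injectiveb codeI.
    by apply/negP => /injectiveP/leq_card; rewrite card_ord ltnn.
  case/injectivePn => k [l ne_kl eq_kl].
  have [lt_kl|lt_lk|/val_inj eq'] := ltngtP k l.
  - by exists k, l.
  - by exists l, k.
  - by rewrite eq' eqxx in ne_kl.
have subB k l y : code k = code l -> B k y -> B l y.
  move=> eq_kl By; have res_ge0 i0 : 0 <= res y i0 by rewrite modz_ge0 // -lt0n.
  have res_lt i0 : (`|res y i0| < W)%N.
    by rewrite -ltz_nat gez0_abs // ltz_pmod.
  pose v : T := [ffun i0 => Ordinal (res_lt i0)].
  have : v \in code k.
    rewrite inE; apply/asboolP; exists y => // i0.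
    by rewrite ffunE /= gez0_abs.
  rewrite eq_kl inE => /asboolP[z Bz vz].
  have [a int_a def_yz] : exists2 a, intg a & y - z = a * M%:R.
    apply: res_eq => [||i0]; [exact: intB By | exact: intB Bz |].
    by rewrite -vz ffunE /= gez0_abs.
  have -> : y = z - ((- a) * M%:R) by rewrite mulNr -def_yz; ring.
  by apply: BB => //; apply: BM; apply: integral_opp.
exists i, j, (x j / x i); split=> // [|y]; first by rewrite mulf_neq0 ?invr_eq0.
rewrite !BE; have -> : x j / x i * y / x j * M%:R = y / x i * M%:R.
  by field; rewrite !nzx.
by split; apply: subB.
Qed.

End IntegralBasis.
End Lattice.

Section ClassTorsion.
Local Open Scope classical_set_scope.
Local Open Scope ring_scope.
Variables (F : fieldExtType rat) (L : splittingFieldType F) (K : {subfield L}).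

(** The finiteness argument concerns extensions of the rationals, whereas [K] is an [F]-subspace of
    [L]. *)
Lemma subfield_over_rat :
  exists (K0 : fieldExtType rat) (iota : {rmorphism K0 -> L}),
  forall x, x \in K <-> exists y, iota y = x.
Proof.
pose K0 : fieldExtType rat := subvs_of (baseAspace K).
pose iota : {rmorphism K0 -> baseFieldType L} :=
  GRing.RMorphism.clone _ _ (@vsval rat (baseFieldType L) (baseAspace K)) _.
exists K0, iota => x; split=> [Kx|[y <-]].
  have Kx0 : (x : baseFieldType L) \in baseAspace K by rewrite mem_baseVspace.
  by exists (Subvs Kx0).
by have := subvsP y; rewrite mem_baseVspace.
Qed.

Lemma fracideal_neq0 (a : fracideal K) : exists2 x, (a : set L) x & x != 0.
Proof.
have [A [b [Ab1 aA _]]] := ex_generates a.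
have [[i nzi]|A0] := pselect (exists i, A`_i != 0); first by exists A`_i.
have /eqP := Ab1; rewrite big1 ?(eq_sym 0) ?oner_eq0 // => i _.
by have [->|nzi] := eqVneq A`_i 0; [rewrite mul0r | case: A0; exists i].
Qed.

Lemma fracideal_mulr_principal (a b : fracideal K) (c : L) :
  c \in K -> c != 0 ->
  (b : set L) = [set c * x | x in (a : set L)] -> b - a \in @principal _ _ K.
Proof.
move=> Kc nzc def_b; apply/asboolP; exists c; split=> //.
have [_ O0 OD OM] := ring_int_submod K; rewrite fracidealDE def_b.
apply/seteqP; split.
  apply: idealM_min => [|_ _ [u Ou <-] [v Ov <-]|_ v [u au <-] bv].
  - by exists 0; rewrite ?mulr0.
  - by exists (u + v); rewrite ?mulrDr //; apply: OD.
  - by exists (u * v); rewrite ?mulrA //; apply: fracideal_mulN au bv.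
have [A [d [Ad1 aA ad]]] := ex_generates a.
have [_ D0 DD DM] := fracideal_submod (- a).
move=> _ [v Ov <-]; rewrite -[v]mulr1 -Ad1 !mulr_sumr.
apply: (big_ind (idealM _ _)) => [||i _]; [exact: idealM0 | exact: idealMD |].
have -> : c * (v * (A`_i * d i)) = (c * A`_i) * (v * d i) by ring.
by apply: idealM_mul; [exists A`_i | apply: DM].
Qed.

(** The pigeonhole principle applied to the powers of one ideal: two of them differ by a principal
    factor. *)
Lemma Cl_torsion (c : Cl K) : exists2 m, (0 < m)%N & c *+ m = 0.
Proof.
have [K0 [iota Kiota]] := subfield_over_rat.
have intE y : integralOver (intr : int -> K0) y <->
              integralOver (intr : int -> L) (iota y).
  have intrE : iota \o intr =1 (intr : int -> L).
    by move=> z; rewrite /= rmorph_int.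
  split=> [[p mon_p py0]|[p mon_p py0]]; exists p => //.
    rewrite -(eq_map_poly intrE) map_poly_comp rootE horner_map.
    by rewrite (eqP py0) rmorph0.
  move: py0; rewrite -(eq_map_poly intrE) map_poly_comp rootE horner_map.
  by rewrite fmorph_eq0.
have OE y : ring_int K (iota y) <-> integralOver (intr : int -> K0) y.
  rewrite intE; split=> [[]//|int_y]; split=> //; apply/Kiota; by exists y.
have KE (a : fracideal K) x : (a : set L) x -> exists y, iota y = x.
  by have [[aK _ _ _] _] := fracidealP a; move/aK/Kiota.
pose a : fracideal K := generic_quotient.repr c.
pose A k y := (a *+ k : set L) (iota y).
have idA k : is_ideal (A k).
  have ak := fracideal_submod (a *+ k); have [_ aD aN] := is_submod_addclosed ak.
  have [_ _ _ aM] := ak; split=> [x y Ax Ay|x y int_x Ay||].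
  - by rewrite /A rmorphB; apply: (aD) => //; apply: aN.
  - by rewrite /A rmorphM; apply: aM => //; apply/OE.
  - have [x ax nzx] := fracideal_neq0 (a *+ k); have [y def_x] := KE _ _ ax.
    by exists y; rewrite /A ?def_x // -(fmorph_eq0 iota) def_x.
  - have [x ax nzx] := fracideal_neq0 (- (a *+ k)); have [y def_x] := KE _ _ ax.
    exists y => [|z Az]; first by rewrite -(fmorph_eq0 iota) def_x.
    apply/OE; rewrite rmorphM mulrC def_x; exact: fracideal_mulN Az ax.
have [w [q [int_w wq qP qw]]] := integral_basis K0.
have [i [j [d [lt_ij nzd dP]]]] := ideal_class_pigeonhole int_w wq qP qw idA.
exists (j - i)%N; first by rewrite subn_gt0.
rewrite -[c]reprK -raddfMn mulrnBr ?(ltnW lt_ij) //.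
apply/eqP; rewrite -[X in _ == X](raddf0 (\pi_(Cl K)%qT)) -Quotient.idealrBE subr0.
apply: (fracideal_mulr_principal (c := iota d)).
- by apply/Kiota; exists d.
- by rewrite fmorph_eq0.
apply/seteqP; split=> [x ax|_ [x ax <-]].
  have [y def_x] := KE _ _ ax; exists (iota (y / d)).
    by apply/dP; rewrite /A mulrCA mulfV // mulr1 def_x.
  by rewrite -rmorphM mulrCA mulfV // mulr1.
have [y def_x] := KE _ _ ax; rewrite -def_x -rmorphM.
by apply/dP; rewrite /A def_x.
Qed.

End ClassTorsion.

(** * Norms to fixed fields *)

Lemma pi_Cl_eq0 (F : fieldExtType rat) (L : splittingFieldType F)
    (K : {subfield L}) (a : fracideal K) :
  (\pi_(Cl K)%qT a == 0) = (a \in @principal _ _ K).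
Proof.
by rewrite -[X in _ == X](raddf0 (\pi_(Cl K)%qT)) -Quotient.idealrBE subr0.
Qed.

Section SylowMap.
Variables (V : zmodType) (p : nat) (f : {additive V -> V}).

Fact sylow_map_subproof (x : sylow V p) : f (sylow_val x) \in ptorsion p.
Proof.
have /asboolP[k xk] := valP x; apply/asboolP; exists k.
by rewrite -raddfMn xk raddf0.
Qed.

Definition sylow_map (x : sylow V p) : sylow V p :=
  Defs.Sylow (sylow_map_subproof x).

Fact sylow_map_zmod_morphism : zmod_morphism sylow_map.
Proof. by move=> x y; apply: val_inj; rewrite /= raddfB. Qed.
HB.instance Definition _ := GRing.isZmodMorphism.Build _ _
  sylow_map sylow_map_zmod_morphism.

End SylowMap.

Section GaloisAction.
Local Open Scope quotient_scope.
Variables (F : fieldExtType rat) (L : splittingFieldType F) (K : {subfield L}).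
Implicit Types (s t : gal_of K).

Lemma gal_Cl1 (c : Cl K) : gal_Cl 1%g c = c.
Proof.
rewrite -[c]reprK gal_ClE; congr (\pi_(_) _); apply: fracideal_inj.
rewrite /=; under eq_imagel do rewrite gal_id.
by rewrite image_id.
Qed.

Lemma gal_ClM s t (c : Cl K) : gal_Cl (s * t)%g c = gal_Cl t (gal_Cl s c).
Proof. by rewrite -[c]reprK (gal_ClE s) !gal_ClE gal_fracidealM. Qed.

End GaloisAction.

Section NormPrimeToP.
Local Open Scope quotient_scope.
Variables (F : fieldExtType rat) (L : splittingFieldType F) (p : nat).
Local Notation E := {:L}%AS.
Local Notation Gamma := 'Gal({:L} / 1)%G.
Hypothesis p_pr : prime p.
Hypothesis Cl_p_sub : forall K : {subfield L},
  normalField 1 K -> (K != {:L} :> {vspace L})%VS ->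
  forall c : sylow (relCl K) p, c = 0.

(** The norm of [c] to the base field has order prime to [p]. This covers both relative classes and,
    when [Cl_p(F)] is trivial, all classes. *)
Definition norm_p'torsion (c : Cl E) : Prop :=
  exists (a : fracideal E) (d : fracideal 1%AS) (m : nat),
    [/\ c = \pi_(Cl E) a, is_norm a d, ~~ (p %| m)%N & \pi_(Cl 1%AS) d *+ m = 0].

(** The sum over [H] is the extension to [L] of the norm [b] of [a] to the fixed field [K], a proper
    normal subextension because [H] is nontrivial and normal. *)
Lemma gal_Cl_sum_p' (H : {group gal_of E}) (c : Cl E) :
    (H <| Gamma)%g -> H != 1%G -> norm_p'torsion c ->
  exists2 m, ~~ (p %| m)%N & (\sum_(h in H) gal_Cl h c) *+ m = 0.
Proof.
move=> nHG ntH [a [d [m [def_c nad p'm d0]]]].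
pose K : {subfield L} := fixedField_aspace H.
have memK x : x \in K <-> forall h, h \in H -> h x = x.
  by split=> [/mem_fixedFieldP[]//|fixx]; apply/fixedFieldP; rewrite ?memvf.
have galK : 'Gal(E / K)%g = H by apply: gal_fixedField.
have nK : normalField 1 K.
  by have /and3P[] := normal_fixedField_galois (galois_full 1%AS) nHG.
have neqK : (K != {:L} :> {vspace L})%VS.
  apply: contra ntH => /eqP eqK; rewrite -val_eqE /= finset.eqEsubset sub1G andbT.
  apply/fintype.subsetP => h Hh; rewrite inE; apply/gal_eqP => x _.
  rewrite gal_id; apply: (memK x).1 h Hh.
  by rewrite -[x \in K]/(x \in (K : {vspace L})) eqK memvf.
have [b def_b] := ex_norm a (fun x => iff_sym (memK x)).
have nbd : is_norm b d.
  by apply: is_norm_trans nK _ nad; rewrite galK.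
have [m1 m1_gt0 b0] := Cl_torsion (\pi_(Cl K) b).
have [m2 co_m2 def_m1] := pfactor_coprime p_pr m1_gt0.
(* The factor [m] makes the norm to the base field trivial, and [m2], the part of [m1] prime to [p],
   leaves a class of [p]-power order. *)
pose e := b *+ (m * m2).
have e_ker : \pi_(Cl K) e \in @norm_ker _ _ K.
  apply/asboolP; exists e, (d *+ (m * m2)); split=> //.
    by rewrite raddfMn mulrnA /= d0 mul0rn.
  rewrite /is_norm raddfMn /= nbd -sumrMnl; apply: eq_bigr => s _.
  by rewrite raddfMn.
have e_tor : RelCl e_ker \in ptorsion p.
  apply/asboolP; exists (logn p m1); apply: val_inj.
  rewrite raddfMn /= /e raddfMn -mulrnA -mulnA -def_m1 mulnC mulrnA.
  by rewrite b0 mul0rn.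
have /(congr1 (fun z => relCl_val (sylow_val z)))/= e0 :=
  Cl_p_sub nK neqK (Defs.Sylow e_tor).
exists (m * m2)%N; first by rewrite Euclid_dvdM // negb_or p'm -prime_coprime.
have : ext_full e \in @principal _ _ E.
  by apply/ext_full_principal; rewrite -pi_Cl_eq0 e0.
rewrite -pi_Cl_eq0 /e !raddfMn /= def_b raddf_sum => /eqP sum0.
rewrite -[RHS]sum0; congr (_ *+ _).
by apply: eq_bigr => h _; rewrite def_c gal_ClE.
Qed.

Lemma norm_ker_p'torsion (c : Cl E) : c \in @norm_ker _ _ E -> norm_p'torsion c.
Proof.
case/asboolP=> a [d [-> d0 nad]]; exists a, d, 1%N.
by split=> //; rewrite ?dvdn1 -?d0 // neq_ltn prime_gt1 // orbT.
Qed.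

(** The part prime to [p] of an exponent of the norm class already kills it, since no nonzero class
    of the base field has [p]-power order. *)
Lemma Cl_p'torsion : (forall c : sylow (Cl (1%AS : {subfield L})) p, c = 0) ->
  forall c : Cl E, norm_p'torsion c.
Proof.
move=> ClF0 c; pose a := generic_quotient.repr c.
have [d def_d] := ex_norm a (fix_gal_full 1%AS).
have [m1 m1_gt0 d0] := Cl_torsion (\pi_(Cl 1%AS) d).
have [m2 co_m2 def_m1] := pfactor_coprime p_pr m1_gt0.
exists a, d, m2; split.
- by rewrite reprK.
- exact/is_norm_full.
- by rewrite -prime_coprime.
have d_tor : \pi_(Cl 1%AS) d *+ m2 \in ptorsion p.
  by apply/asboolP; exists (logn p m1); rewrite -mulrnA -def_m1.
have /(congr1 (fun z => sylow_val z)) := ClF0 (Defs.Sylow d_tor); exact.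
Qed.

End NormPrimeToP.

(** * The kernel of the action on the relative class group modulo [p] *)

Section Faithful.
Variables (F : fieldExtType rat) (L : splittingFieldType F) (K : {subfield L}).
Variables (p : nat) (G : {group gal_of K}).
Local Notation Phi := (relCl_pquot_action K p).

Definition relCl_kernel : {set gal_of K} :=
  [set s in G | `[< forall c, Phi c s = c >]].

Lemma relCl_kernelP s :
  reflect (s \in G /\ forall c, Phi c s = c) (s \in relCl_kernel).
Proof.
by rewrite inE; apply: (iffP andP) => -[Gs /asboolP].
Qed.

Let Phi1 c : Phi c 1%g = c. Proof. exact: act_relCl_pquot1. Qed.
Let PhiM c s t : Phi c (s * t)%g = Phi (Phi c s) t.
Proof. exact: act_relCl_pquotM. Qed.

Fact relCl_kernel_group_set : group_set relCl_kernel.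
Proof.
apply/group_setP; split=> [|s t /relCl_kernelP[Gs fixs] /relCl_kernelP[Gt fixt]].
  by apply/relCl_kernelP; split=> [|c]; rewrite ?group1 ?Phi1.
by apply/relCl_kernelP; split=> [|c]; rewrite ?groupM // PhiM fixs fixt.
Qed.
Canonical relCl_kernel_group := Group relCl_kernel_group_set.

Lemma relCl_kernel_normal : (relCl_kernel <| G)%g.
Proof.
apply/normalP; split; first by apply/fintype.subsetP => s /relCl_kernelP[].
have sub t : t \in G -> (relCl_kernel :^ t)%g \subset relCl_kernel.
  move=> Gt; apply/fintype.subsetP => _ /imsetP[s /relCl_kernelP[Gs fixs] ->].
  apply/relCl_kernelP; split=> [|c]; first by rewrite groupJ.
  by rewrite conjgE !PhiM fixs -PhiM mulVg Phi1.
move=> t Gt; apply/eqP; rewrite finset.eqEsubset sub //=.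
by rewrite -sub_conjgV sub ?groupV.
Qed.

End Faithful.

Theorem theorem11 (F : fieldExtType rat) (L : splittingFieldType F) (p : nat)
    (p_prime : prime p)
    (p_ndvd : ~~ (p %| #|'Gal({:L} / 1)%g|)%N)
    (Cl_p_sub : forall K : {subfield L},
       normalField 1 K -> (K != {:L} :> {vspace L})%VS ->
       forall c : sylow (relCl K) p, c = 0) :
  let Gamma := 'Gal({:L} / 1)%G in
  let ClLF := relCl {:L}%AS in
  let Phi := relCl_pquot_action {:L}%AS p in
  let rankLF := prank p (sylow ClLF p) in
  let rankL := prank p (sylow (Cl {:L}%AS) p) in
  let Cl_pF_trivial := forall c : sylow (Cl (1%AS : {subfield L})) p, c = 0 in
  ((exists c : pquot ClLF p, c != 0) ->
     forall s, s \in Gamma -> (forall c, Phi c s = c) -> s = 1%g)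
  /\
  forall (E : fieldType) (f : nat),
    p \in [pchar E] -> group_splitting_field E Gamma ->
    (forall n (rG : mx_representation E Gamma n),
       mx_irreducible rG -> mx_faithful rG -> (f %| n)%N) ->
    [/\ rankLF = 0 %[mod f],
        Cl_pF_trivial -> rankL = 0 %[mod f]
      & forall r : nat,
          (forall n (rG : mx_representation E Gamma n),
             mx_irreducible rG -> mx_faithful rG ->
             has_fp_dim p (char_field rG) r) ->
          rankLF = 0 %[mod r * f] /\
          (Cl_pF_trivial -> rankL = 0 %[mod r * f])].
Proof.
move=> Gamma ClLF Phi rankLF rankL Cl_pF_trivial; split.
  move=> [c nzc] s Gs fixs; apply/eqP; apply: contraNT nzc => nts.
  (* A nontrivial [s] makes the kernel a nontrivial normal subgroup; it fixes every class, so
     [pquot_fix0] forces [c] to vanish. *)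
  have ker_s : s \in relCl_kernel p Gamma by apply/relCl_kernelP.
  have ntH : relCl_kernel_group p Gamma != 1%G.
    apply: contraNneq nts => H1.
    by have : s \in relCl_kernel_group p Gamma := ker_s; rewrite H1 inE.
  apply/eqP; apply: (@pquot_fix0 p ClLF p_prime _ Gamma
    (fun s => gal_relCl s) p_ndvd _ _ c (relCl_kernel_normal p Gamma) ntH).
    move=> H x nHG ntH'.
    have [m p'm sum0] := gal_Cl_sum_p' p_prime Cl_p_sub nHG ntH'
      (norm_ker_p'torsion p_prime (valP x)).
    exists m => //; apply: val_inj; rewrite raddfMn raddf_sum; exact: sum0.
  by move=> h /relCl_kernelP[_]; apply.
move=> E f pcharE splitG dvd_f.
(* Both ranks are treated alike; only the reason why norms to the base field have order prime to [p]
   differs. *)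
have rank_dvd (r : nat) : (forall n (rG : mx_representation E Gamma n),
      mx_irreducible rG -> mx_faithful rG -> r = 1%N \/ has_fp_dim p (char_field rG) r) ->
    (r * f %| rankLF)%N /\ (Cl_pF_trivial -> (r * f %| rankL)%N).
  move=> dim_r; split=> [|ClF0].
    refine (@prank_dvd p (sylow ClLF p) p_prime _ Gamma
      (fun s => sylow_map (gal_relCl s)) _ _ p_ndvd _ E r f pcharE splitG dvd_f dim_r).
    - by move=> x; do 2!apply: val_inj; apply: gal_Cl1.
    - by move=> s t _ _ x; do 2!apply: val_inj; apply: gal_ClM.
    move=> H x nHG ntH.
    have [m p'm sum0] := gal_Cl_sum_p' p_prime Cl_p_sub nHG ntH
      (norm_ker_p'torsion p_prime (valP (sylow_val x))).
    exists m => //; do 2!apply: val_inj.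
    rewrite (raddfMn val) (raddf_sum val) (raddfMn val) (raddf_sum val); exact: sum0.
  refine (@prank_dvd p (sylow (Cl {:L}%AS) p) p_prime _ Gamma
    (fun s => sylow_map (gal_Cl s)) _ _ p_ndvd _ E r f pcharE splitG dvd_f dim_r).
  - by move=> x; apply: val_inj; apply: gal_Cl1.
  - by move=> s t _ _ x; apply: val_inj; apply: gal_ClM.
  move=> H x nHG ntH.
  have [m p'm sum0] := gal_Cl_sum_p' p_prime Cl_p_sub nHG ntH
    (Cl_p'torsion p_prime ClF0 (sylow_val x)).
  exists m => //; apply: val_inj; rewrite (raddfMn val) (raddf_sum val); exact: sum0.
have mod0 d k : (d %| k)%N -> k = 0 %[mod d] by move=> /eqP->; rewrite mod0n.
have [|dvdLF dvdL] := rank_dvd 1%N; first by left.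
rewrite mul1n in dvdLF dvdL.
split=> [|/dvdL|r dim_r]; [exact: mod0 | exact: mod0 |].
have [|rLF rL] := rank_dvd r; first by move=> *; right; apply: dim_r.
by split=> [|/rL]; apply: mod0.
Qed.
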